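(* Let $S=\{(x_i,y_i)\}_{i=1}^n$ be i.i.d. samples from the linear model $y_i=x_i^T\beta^*+z_i$, where $\beta^*\in\mathbb{R}^p$, the covariates $x_i\in\mathbb{R}^p$ satisfy $\mathbb{E}x_i=0$, $\mathbb{E}x_ix_i^T=I$ and $(4,2)$-hypercontractivity with parameter $\sigma_{x,4}\le C$ for a known constant $C$, and the noise satisfies $\mathbb{E}|z_i|=\kappa<\infty$. For an $\epsilon<c^*$, where $c^*>0$ is a small enough constant, let $T$ be an $\epsilon$-corrupted version of $S$. Let $\widehat\beta$ be the output of the algorithm LAD with Filtering (defined in the context) with inputs $T$ and $\epsilon'$, where $\epsilon'$ is a small enough constant. Let $\tau\in(0,1)$ be such that $\frac{\log(1/\tau)}{n}=O(1)$. Then with probability at least $1-\tau$, $$\|\widehat\beta-\beta^*\|_2=O(\kappa),\quad\text{as long as } n=\Omega(p\log p).$$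
   Context: The noise $z_i$ is not required to be independent of $x_i$ nor to have mean zero; the pairs $(x_i,z_i)$ are i.i.d. Hypercontractivity: a random vector $X\in\mathbb{R}^p$ satisfies $(4,2)$-hypercontractivity with parameter $\sigma_4$ if $(\mathbb{E}|v^TX|^4)^{1/4}\le\sigma_4(\mathbb{E}(v^TX)^2)^{1/2}$ for all unit vectors $v$. Corruption (strong contamination model): $T$ is an $\epsilon$-corrupted version of $S$ if $|T|=|S|$ and $|T\cap S|\ge(1-\epsilon)|S|$; $T$ may depend on $S$ arbitrarily. Stability: for $0<\epsilon<1/2$ and $\delta\ge\epsilon$, a finite multiset $S\subset\mathbb{R}^p$ is $(\epsilon,\delta)$-stable with respect to $\mu$ and $\sigma^2$ if for all $S'\subseteq S$ with $|S'|\ge(1-\epsilon)|S|$: $\left\|\frac1{|S'|}\sum_{x\in S'}x-\mu\right\|_2\le\sigma\delta$ and $\left\|\frac1{|S'|}\sum_{x\in S'}(x-\mu)(x-\mu)^T-\sigma^2I\right\|_2\le\frac{\sigma^2\delta^2}{\epsilon}$. Filter: FilteredCovariates$(T,\epsilon')$ is the iterative filtering algorithm from robust mean estimation, a computationally efficient randomized algorithm which takes a finite multiset $T\subset\mathbb{R}^p$ and $\epsilon'<1/2$ and outputs $T'\subseteq T$ (identified with the set of retained indices), with the following guarantee, for absolute constants $c_1,c_2,c_3>0$ and any large enough constant $C_0>1$: if $T$ is an $\epsilon'$-corrupted version of a multiset $S$ of $n$ points containing $S'\subseteq S$ with $|S'|\ge(1-\epsilon')|S|$ that is $(C_0\epsilon',\delta)$-stable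 with respect to $\mu$ and $\sigma^2$, then with probability at least $1-O(\exp(-\Omega(n\epsilon')))$ over its internal randomness, $|T'|\ge(1-c_1\epsilon')|T|$ and $T'$ is $(c_2C_0\epsilon',c_3\delta)$-stable with respect to $\mu$ and $\sigma^2$. Algorithm LAD with Filtering, input $(x_i',y_i')_{i\in[n]},\epsilon'$: (1) $T_1\leftarrow$ FilteredCovariates$((x_i')_{i\in[n]},\epsilon')$; (2) return $\widehat\beta\in\arg\min_\beta\sum_{i\in T_1}|y_i'-x_i'^T\beta|$. Constants: implied constants are positive and may depend only on $C$ and on the constant $\epsilon'$. In hypotheses, $A=O(1)$ means $A$ is at most a sufficiently small constant, and $A=\Omega(B)$ means $A\ge C'B$ with $C'$ sufficiently large.
   Formalization: The condition n = Ω(p log p) is read as n ≥ C'·max(1, p log p); this differs only for p = 1, where p log p = 0 and the claim would fail for very small n because the filter's guarantee is then vacuous. *)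

(* Defs.v *)
From mathcomp Require Import all_boot all_order all_algebra.
From mathcomp Require Import finmap multiset.
From mathcomp Require Import all_classical all_reals all_analysis.

Set Implicit Arguments.
Unset Strict Implicit.
Unset Printing Implicit Defensive.

Import Order.TTheory GRing.Theory Num.Theory.

Local Open Scope classical_set_scope.
Local Open Scope ring_scope.

Section LinearAlgebra.
Variables (R : realType) (p : nat).

Definition dot (u v : 'cV[R]_p) : R := \sum_(k < p) u k 0 * v k 0.

(* The library norm on matrices is the max norm, hence these two definitions. *)
Definition norm2 (v : 'cV[R]_p) : R := Num.sqrt (\sum_(k < p) v k 0 ^+ 2).

Definition opnorm (M : 'M[R]_p) : R :=
  sup [set norm2 (M *m v) | v in [set v : 'cV[R]_p | norm2 v <= 1]].

End LinearAlgebra.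

(* A finite multiset of n points is a family indexed by 'I_n, and a
   sub-multiset of it is a set of indices. *)
Section Multisets.
Variable R : realType.

(* |T| = |S| = n is built in; the order in which T is listed is arbitrary, as
   only the intersection of the underlying multisets matters. *)
Definition corrupted (K : choiceType) (n : nat) (eps : R) (S T : 'I_n -> K)
    : Prop :=
  (1 - eps) * n%:R
    <= (size (seq_mset (codom T) `&` seq_mset (codom S))%mset)%:R.

Variables (p n : nat).

Definition mean (x : 'I_n -> 'cV[R]_p) (A : {set 'I_n}) : 'cV[R]_p :=
  #|A|%:R^-1 *: \sum_(i in A) x i.

Definition second_moment (x : 'I_n -> 'cV[R]_p) (mu : 'cV[R]_p)
    (A : {set 'I_n}) : 'M[R]_p :=
  #|A|%:R^-1 *: \sum_(i in A) ((x i - mu) *m (x i - mu)^T).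

Definition stability_range (eps delta : R) : Prop :=
  0 < eps < 2^-1 /\ eps <= delta.

(* The sub-multiset A of x is (eps, delta)-stable w.r.t. mu and sigma ^+ 2. *)
Definition stable (x : 'I_n -> 'cV[R]_p) (A : {set 'I_n})
    (eps delta : R) (mu : 'cV[R]_p) (sigma : R) : Prop :=
  stability_range eps delta /\
  forall B : {set 'I_n}, B \subset A -> (1 - eps) * #|A|%:R <= #|B|%:R ->
    norm2 (mean x B - mu) <= sigma * delta /\
    opnorm (second_moment x mu B - (sigma ^+ 2)%:M)
      <= sigma ^+ 2 * delta ^+ 2 / eps.

End Multisets.

Record fdist (R : realType) (A : finType) := FDist {
  pmf :> A -> R;
  pmf_ge0 : forall a, 0 <= pmf a;
  pmf_sum1 : \sum_a pmf a = 1 }.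

Definition fprob (R : realType) (A : finType) (mu : fdist R A) (E : set A) : R :=
  \sum_(a | `[< E a >]) mu a.

(* A randomized algorithm mapping a multiset of points and a parameter to a
   sub-multiset, represented by the law of its output on each input. *)
Definition filter_algorithm (R : realType) : Type :=
  forall p n : nat, ('I_n -> 'cV[R]_p) -> R -> fdist R {set 'I_n}.

(* [A] and [a] are the constants implied in 1 - O(exp(-Omega(n eps))); C0 is
   large enough when Cbar <= C0.  The last premise restricts the guarantee to
   parameters for which stability of the output is meaningful. *)
Definition filter_guarantee (R : realType) (F : filter_algorithm R)
    (c1 c2 c3 Cbar A a : R) : Prop :=
  forall (C0 : R), Cbar <= C0 ->
  forall (p n : nat) (S T : 'I_n -> 'cV[R]_p) (S' : {set 'I_n})
         (eps delta : R) (mu : 'cV[R]_p) (sigma : R),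
    0 < eps < 2^-1 -> 0 < sigma ->
    corrupted eps S T ->
    (1 - eps) * n%:R <= #|S'|%:R ->
    stable S S' (C0 * eps) delta mu sigma ->
    stability_range (c2 * C0 * eps) (c3 * delta) ->
    1 - A * expR (- (a * (n%:R * eps))) <=
      fprob (F p n T eps)
        [set T' : {set 'I_n} | (1 - c1 * eps) * n%:R <= #|T'|%:R /\
                  stable T T' (c2 * C0 * eps) (c3 * delta) mu sigma].

Section LAD.
Variables (R : realType) (p n : nat).

Definition lad_loss (D : 'I_n -> 'cV[R]_p * R) (A : {set 'I_n})
    (b : 'cV[R]_p) : R :=
  \sum_(i in A) `| (D i).2 - dot (D i).1 b |.

Definition lad_argmin (D : 'I_n -> 'cV[R]_p * R) (A : {set 'I_n})
    : set 'cV[R]_p :=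
  [set b | forall b' : 'cV[R]_p, lad_loss D A b <= lad_loss D A b'].

(* Probability, over the randomness of the filter F, that the output of LAD
   with filtering on (D, eps) lies in E however ties in the arg min are
   broken. *)
Definition lad_filtering_prob (F : filter_algorithm R)
    (D : 'I_n -> 'cV[R]_p * R) (eps : R) (E : set 'cV[R]_p) : R :=
  fprob (F p n (fun i => (D i).1) eps) [set T1 : {set 'I_n} | lad_argmin D T1 `<=` E].

End LAD.

Section Samples.
Variables (R : realType) (d : measure_display) (Omega : measurableType d).
Variables (P : probability Omega R) (p : nat).

(* The pair (X, Z) as a map into a type that carries the Borel sigma-algebra
   of R^p x R. *)
Definition pair_obs (X : Omega -> 'cV[R]_p) (Z : Omega -> R) (w : Omega)
    : p.-tuple R * R := ([tuple X w k 0 | k < p], Z w).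

Definition iid_pairs (n : nat) (x : 'I_n -> Omega -> 'cV[R]_p)
    (z : 'I_n -> Omega -> R) : Prop :=
  [/\ forall i, measurable_fun setT (pair_obs (x i) (z i)),
      forall i j (B : set (p.-tuple R * R)), measurable B ->
        P (pair_obs (x i) (z i) @^-1` B) = P (pair_obs (x j) (z j) @^-1` B) &
      forall B : 'I_n -> set (p.-tuple R * R), (forall i, measurable (B i)) ->
        P (\bigcap_i (pair_obs (x i) (z i) @^-1` B i)) =
        (\prod_(i < n) P (pair_obs (x i) (z i) @^-1` B i))%E].

Local Open Scope ereal_scope.

Definition mean_zero (X : Omega -> 'cV[R]_p) : Prop :=
  forall k, 'E_P[fun w => (X w k 0)%R] = 0.

Definition second_moment_id (X : Omega -> 'cV[R]_p) : Prop :=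
  forall k l, 'E_P[fun w => (X w *m (X w)^T)%R k l] = ((1%:M : 'M[R]_p) k l)%:E.

Definition hypercontractive42 (X : Omega -> 'cV[R]_p) (sigma4 : R) : Prop :=
  forall v : 'cV[R]_p, norm2 v = 1%R ->
    'E_P[fun w => (`|dot v (X w)| ^+ 4)%R] `^ (4^-1)
      <= sigma4%:E * 'E_P[fun w => (dot v (X w) ^+ 2)%R] `^ (2^-1).

End Samples.

(* Main.v *)
(* Since the fraction of corrupted points and the constant in front of kappa may
   depend on eps', only crude bounds are needed.  With probability
   1 - exp(- Omega(n)) the clean sample has three properties.

   1. After deletion of at most eps' n points, sum_i (x_i . v)^2 <= Lam n |v|^2
      for all v.  The points are presented one at a time to the barrier
      potential tr (B^-1); a point that would make the potential grow is
      deleted, and conditionally on the past this has small probability, so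
      that the number of deletions has binomial tails.  A large second moment
      bound is enough for stability with a large delta.
   2. At most gamma n noises exceed (4 / gamma) kappa; these points can be
      treated as corrupted.
   3. For all unit u there is a nearby grid point v such that a constant
      fraction of the x_i has |x_i . v| >= 1/4.  This follows for a fixed v from
      the fourth moments, and for all grid points by a union bound over
      exp(O(p log p)) of them.

   The filter then returns a set on which sum_i (x_i . v)^2 <= L n |v|^2.  By
   Cauchy-Schwarz the few bad points contribute little to
   sum_i |x_i . (betahat - betastar)|, whereas by 3 the good points contribute
   a constant multiple of n |betahat - betastar|; comparing the losses at
   betahat and betastar concludes. *)

Require Import Defs.
From mathcomp Require Import all_boot all_order all_algebra.
From mathcomp Require Import finmap multiset.
From mathcomp Require Import fingroup perm.
From mathcomp Require Import all_classical all_reals all_analysis.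
From mathcomp Require Import measurable_realfun.
From mathcomp Require Import ring lra.

Set Implicit Arguments.
Unset Strict Implicit.
Unset Printing Implicit Defensive.

Import Order.TTheory GRing.Theory Num.Theory.

Local Open Scope classical_set_scope.
Local Open Scope ring_scope.

(** * Dot products *)

Section DotProduct.
Variables (R : realType) (p : nat).
Implicit Types (u v w : 'cV[R]_p) (M : 'M[R]_p).

Lemma dotE u v : dot u v = (u^T *m v) 0 0.
Proof. by rewrite mxE; apply: eq_bigr => k _; rewrite mxE. Qed.

Lemma dotC u v : dot u v = dot v u.
Proof. by apply: eq_bigr => k _; rewrite mulrC. Qed.

Lemma dotDr u v w : dot u (v + w) = dot u v + dot u w.
Proof. by rewrite !dotE mulmxDr mxE. Qed.

Lemma dotNr u v : dot u (- v) = - dot u v.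
Proof. by rewrite !dotE mulmxN mxE. Qed.

Lemma dotBr u v w : dot u (v - w) = dot u v - dot u w.
Proof. by rewrite dotDr dotNr. Qed.

Lemma dotZr a u v : dot u (a *: v) = a * dot u v.
Proof. by rewrite !dotE -scalemxAr mxE. Qed.

Lemma dotDl u v w : dot (u + v) w = dot u w + dot v w.
Proof. by rewrite !(dotC _ w) dotDr. Qed.

Lemma dotBl u v w : dot (u - v) w = dot u w - dot v w.
Proof. by rewrite !(dotC _ w) dotBr. Qed.

Lemma dotZl a u v : dot (a *: u) v = a * dot u v.
Proof. by rewrite !(dotC _ v) dotZr. Qed.

Lemma dot0r u : dot u 0 = 0.
Proof. by rewrite dotE mulmx0 mxE. Qed.

Lemma dot_sumr (I : finType) (r : pred I) u (F : I -> 'cV[R]_p) :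
  dot u (\sum_(i | r i) F i) = \sum_(i | r i) dot u (F i).
Proof.
by apply: (big_morph (dot u)) => [? ?|]; rewrite ?dotDr ?dot0r.
Qed.

Lemma dot_mulmxr M u v : dot u (M *m v) = dot (M^T *m u) v.
Proof. by rewrite !dotE trmx_mul trmxK mulmxA. Qed.

Lemma dot_outer X u v : dot u ((X *m X^T) *m v) = dot X u * dot X v.
Proof.
by rewrite !dotE -!mulmxA mulmxA mxE big_ord1 -dotE dotC dotE.
Qed.

Lemma dotvv_ge0 v : 0 <= dot v v.
Proof. by apply: sumr_ge0 => k _; rewrite -expr2 sqr_ge0. Qed.

Lemma dotvv_eq0 v : (dot v v == 0) = (v == 0).
Proof.
apply/eqP/eqP => [h|->]; last by rewrite dot0r.
apply/matrixP => k j; rewrite ord1 mxE; apply/eqP.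
rewrite -sqrf_eq0 expr2.
by apply/eqP; apply: (psumr_eq0P _ h) => // i _; rewrite -expr2 sqr_ge0.
Qed.

Lemma dotvv_gt0 v : v != 0 -> 0 < dot v v.
Proof. by move=> v0; rewrite lt_neqAle dotvv_ge0 eq_sym dotvv_eq0 v0. Qed.

Lemma norm2E v : norm2 v = Num.sqrt (dot v v).
Proof. by congr Num.sqrt; apply: eq_bigr => k _; rewrite expr2. Qed.

Lemma norm2_ge0 v : 0 <= norm2 v.
Proof. exact: sqrtr_ge0. Qed.

Lemma sqr_norm2 v : norm2 v ^+ 2 = dot v v.
Proof. by rewrite norm2E sqr_sqrtr // dotvv_ge0. Qed.

Lemma norm2Z a v : norm2 (a *: v) = `|a| * norm2 v.
Proof.
rewrite !norm2E dotZl dotZr mulrA -expr2 sqrtrM ?sqr_ge0 //.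
by rewrite sqrtr_sqr.
Qed.

Lemma norm2_gt0 v : (0 < norm2 v) = (v != 0).
Proof.
by rewrite norm2E sqrtr_gt0 lt_neqAle dotvv_ge0 andbT eq_sym dotvv_eq0.
Qed.

(** The quadratic is tested at its minimiser [- b / c]. If c < 0, or if c = 0 and b is nonzero, an
    explicit [t] makes it negative. *)
Lemma discr_le (a b c : R) :
  (forall t, 0 <= a + t * (2 * b) + t ^+ 2 * c) -> b ^+ 2 <= a * c.
Proof.
move=> h; have [c0|c0] := eqVneq c 0.
  have [->|b0] := eqVneq b 0; first by rewrite c0 expr0n mulr0.
  have := h (- (a + 1) / (2 * b)).
  rewrite c0 mulr0 addr0 mulfVK; first by lra.
  by rewrite mulf_neq0.
have c_gt0 : 0 < c.
  rewrite lt_neqAle eq_sym c0 /=; rewrite leNgt; apply/negP => cneg.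
  (* The quotient [t] satisfies t c = -(|a| + 2|b| + 1). Adding 1 gives s >= 1, so that s t c alone
     outweighs a + 2 s b. *)
  have := h ((`|a| + 2 * `|b| + 1) / (- c) + 1).
  set t := (X in X + 1); set s := t + 1.
  have t0 : 0 <= t by rewrite divr_ge0 ?oppr_ge0 ?ltW // !addr_ge0 // mulr_ge0.
  have tc : t * c = - (`|a| + 2 * `|b| + 1).
    by rewrite /t invrN mulrN mulNr mulfVK.
  have -> : s ^+ 2 * c = s * (t * c) + s * c by rewrite /s; ring.
  rewrite tc.
  have := ler_norm a; have := ler_norm b => hb ha.
  have : s * (2 * b) <= s * (2 * `|b|).
    by apply: ler_wpM2l; rewrite /s; lra.
  have : s * c <= c by rewrite /s; nra.
  have : `|a| <= s * `|a| by rewrite /s; have := normr_ge0 a; nra.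
  rewrite /s; lra.
have := h (- b / c).
have -> : a + - b / c * (2 * b) + (- b / c) ^+ 2 * c = (a * c - b ^+ 2) / c.
  by field.
by rewrite ler_pdivlMr // mul0r subr_ge0.
Qed.

Lemma form_cauchy_schwarz M u v : M^T = M ->
  (forall w, 0 <= dot w (M *m w)) ->
  dot u (M *m v) ^+ 2 <= dot u (M *m u) * dot v (M *m v).
Proof.
move=> sM pM; apply: discr_le => t.
have := pM (u + t *: v).
rewrite mulmxDr -scalemxAr dotDl !dotDr !dotZl !dotZr.
rewrite (dot_mulmxr M v u) sM (dotC (M *m v) u).
by congr (0 <= _); ring.
Qed.

Lemma dot_cauchy_schwarz u v : dot u v ^+ 2 <= dot u u * dot v v.
Proof.
have := @form_cauchy_schwarz 1%:M u v (trmx1 _ _).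
by rewrite !mul1mx; apply => w; rewrite mul1mx dotvv_ge0.
Qed.

Lemma dot_le_norm2 u v : `|dot u v| <= norm2 u * norm2 v.
Proof.
rewrite -(@ler_pXn2r _ 2) ?nnegrE ?mulr_ge0 ?norm2_ge0 //.
by rewrite exprMn !sqr_norm2 real_normK ?num_real // dot_cauchy_schwarz.
Qed.

Lemma norm2_triangle u v : norm2 (u + v) <= norm2 u + norm2 v.
Proof.
rewrite -(@ler_pXn2r _ 2) ?nnegrE ?addr_ge0 ?norm2_ge0 //.
rewrite sqrrD !sqr_norm2 dotDl !dotDr (dotC v u).
have := le_trans (ler_norm _) (dot_le_norm2 u v).
by rewrite -mulr_natl; lra.
Qed.

Lemma norm2N v : norm2 (- v) = norm2 v.
Proof. by rewrite -scaleN1r norm2Z normrN normr1 mul1r. Qed.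

Lemma norm2_delta k : norm2 (delta_mx k 0 : 'cV[R]_p) = 1.
Proof.
rewrite norm2E /dot (bigD1 k) //= big1 ?mxE ?eqxx ?mul1r ?addr0 ?sqrtr1 //.
by move=> i /negPf ik; rewrite !mxE ik mul0r.
Qed.

Lemma dot_delta k v : dot (delta_mx k 0) v = v k 0.
Proof.
rewrite /dot (bigD1 k) //= big1 ?mxE ?eqxx ?mul1r ?addr0 //.
by move=> i /negPf ik; rewrite !mxE ik mul0r.
Qed.

Lemma trace_dot M : \tr M = \sum_k dot (delta_mx k 0) (M *m delta_mx k 0).
Proof.
apply: eq_bigr => k _; rewrite dot_delta mxE (bigD1 k) //= big1 ?mxE.
  by rewrite !eqxx mulr1 addr0.
by move=> i /negPf ik; rewrite !mxE ik mulr0.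
Qed.

End DotProduct.

(** * Positive definite matrices *)

Section PositiveDefinite.
Variables (R : realType) (p : nat).
Implicit Types (u v w X : 'cV[R]_p) (B M : 'M[R]_p).

Definition posdef B := B^T = B /\ forall v, v != 0 -> 0 < dot v (B *m v).

Lemma posdef_ge0 B v : posdef B -> 0 <= dot v (B *m v).
Proof.
case=> _ pB; have [->|v0] := eqVneq v 0; last exact/ltW/pB.
by rewrite mulmx0 dot0r.
Qed.

Lemma posdef_unit B : posdef B -> B \in unitmx.
Proof.
case=> sB pB; rewrite unitmxE unitfE; apply/negP => /det0P[u u0 uB].
have := pB u^T; rewrite dotE trmxK mulmxA uB mul0mx mxE ltxx.
by rewrite -(inj_eq trmx_inj) trmxK trmx0 => /(_ u0).
Qed.

Lemma posdef_inv B : posdef B -> posdef (invmx B).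
Proof.
move=> pB; have uB := posdef_unit pB; case: pB => sB pB.
split; first by rewrite trmx_inv sB.
move=> v v0; have -> : v = B *m (invmx B *m v) by rewrite mulKVmx.
rewrite mulKmx // dotC; apply: pB; apply/eqP => Bv0.
by move: v0; rewrite -(mulKVmx uB v) Bv0 mulmx0 eqxx.
Qed.

Lemma dot_scalar (a : R) v : dot v (a%:M *m v) = a * dot v v.
Proof. by rewrite mul_scalar_mx dotZr. Qed.

Lemma posdef_scalar (a : R) : 0 < a -> posdef a%:M.
Proof.
move=> a0; split; first by rewrite tr_scalar_mx.
by move=> v v0; rewrite dot_scalar mulr_gt0 // dotvv_gt0.
Qed.

Lemma posdefD_scalar B (a : R) : posdef B -> 0 <= a -> posdef (B + a%:M).
Proof.
case=> sB pB a0; split; first by rewrite linearD /= sB tr_scalar_mx.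
move=> v v0; rewrite mulmxDl dotDr dot_scalar ltr_wpDr ?pB //.
by rewrite mulr_ge0 // dotvv_ge0.
Qed.

Lemma posdef_trace_ge0 B : posdef B -> 0 <= \tr B.
Proof. by move=> pB; rewrite trace_dot sumr_ge0 // => k _; apply: posdef_ge0. Qed.

Lemma posdef_mulmx_sqr B v : posdef B ->
  dot v ((B *m B) *m v) = dot (B *m v) (B *m v).
Proof. by case=> sB _; rewrite -mulmxA dot_mulmxr sB. Qed.

(** Cauchy-Schwarz for the form [B], applied to B^-1 X and v, gives (X . v)^2 <= (X^T B^-1 X)(v^T B
    v). Hence the downdate removes at most half of v^T B v. *)
Lemma posdef_downdate B X : posdef B ->
  dot X (invmx B *m X) <= 2^-1 -> posdef (B - X *m X^T).
Proof.
move=> pB; have uB := posdef_unit pB; set c := dot X _ => c2.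
split; first by rewrite linearB /= trmx_mul trmxK pB.1.
move=> v v0; rewrite mulmxBl dotBr dot_outer.
have := form_cauchy_schwarz (invmx B *m X) v pB.1 (fun w => @posdef_ge0 B w pB).
rewrite mulKVmx // dot_mulmxr pB.1 mulKVmx // (dotC (invmx B *m X)) -/c expr2.
have := pB.2 v v0; set q := dot v _ => q0 cs.
by nra.
Qed.

(* Sherman-Morrison; the bound 1/2 keeps the denominator 1 - X^T B^-1 X away
   from 0. *)
Lemma trace_inv_downdate B X : posdef B ->
  dot X (invmx B *m X) <= 2^-1 ->
  \tr (invmx (B - X *m X^T))
    <= \tr (invmx B) + 2 * dot X ((invmx B *m invmx B) *m X).
Proof.
move=> pB c2; have uB := posdef_unit pB.
have pI := posdef_inv pB; have pD := posdef_downdate pB c2.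
set I := invmx B in c2 pI *; set c := dot X _ in c2.
have [Y YE] : {Y | Y = I *m X} by exists (I *m X).
set s := (1 - c)^-1.
have c1 : 1 - c != 0 by apply/eqP; lra.
have YT : Y^T = X^T *m I by rewrite YE trmx_mul pI.1.
have inv2 : (B - X *m X^T) *m (I + s *: (Y *m Y^T)) = 1%:M.
  have BY : B *m Y = X by rewrite YE mulKVmx.
  rewrite mulmxDr !mulmxBl mulmxV // -!scalemxAr !mulmxA. rewrite BY.
  have -> : X *m X^T *m Y *m Y^T = c *: (X *m Y^T).
    rewrite -(mulmxA X) [X^T *m Y]mx11_scalar -dotE YE -/c.
    by rewrite mul_mx_scalar -scalemxAl.
  rewrite -(mulmxA X X^T) -YT -scalerBr.
  rewrite -[X in X - c *: _]scale1r -scalerBl scalerA mulVf // scale1r.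
  by rewrite subrK.
have -> : invmx (B - X *m X^T) = I + s *: (Y *m Y^T).
  by rewrite -[RHS](mulKmx (posdef_unit pD)) inv2 mulmx1.
rewrite linearD linearZ /= mxtrace_mulC /mxtrace big_ord1 -dotE.
rewrite posdef_mulmx_sqr // -YE lerD2l ler_wpM2r ?dotvv_ge0 //.
by rewrite /s -[leRHS]invrK lef_pV2 ?posrE; lra.
Qed.

(** How much the potential drops under a shift. With the resolvent identity I - J = a J I used
    twice, the slack in the inequality is exactly a^2 tr (J I J), which is nonnegative. *)
Lemma trace_inv_shift B (a : R) : posdef B -> 0 <= a ->
  \tr (invmx (B + a%:M))
    + a * \tr (invmx (B + a%:M) *m invmx (B + a%:M)) <= \tr (invmx B).
Proof.
move=> pB a0; have pS := posdefD_scalar pB a0.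
have uB := posdef_unit pB; have uS := posdef_unit pS.
have pI := posdef_inv pB; have pJ := posdef_inv pS.
set I := invmx B; set J := invmx (B + a%:M).
have resolvent : I - J = a *: (J *m I).
  have -> : I - J = J *m ((B + a%:M) - B) *m I.
    by rewrite mulmxBr mulVmx // mulmxBl mul1mx -mulmxA mulmxV // mulmx1.
  by rewrite addrAC subrr add0r mul_mx_scalar -scalemxAl.
have : \tr I - \tr J - a * \tr (J *m J) = a ^+ 2 * \tr (J *m I *m J).
  rewrite -[in LHS]linearB /= resolvent linearZ /= -mulrBr -linearB /=.
  rewrite -mulmxBr resolvent -scalemxAr linearZ /= mulrA -expr2; congr (_ * _).
  by rewrite mxtrace_mulC.
have : 0 <= \tr (J *m I *m J).
  rewrite trace_dot sumr_ge0 // => k _; rewrite -!mulmxA.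
  by rewrite dot_mulmxr pJ.1; apply: posdef_ge0.
move=> h1 h2; have : 0 <= a ^+ 2 * \tr (J *m I *m J) by rewrite mulr_ge0 // sqr_ge0.
by rewrite -h2; lra.
Qed.

End PositiveDefinite.

(** * The barrier argument *)

Section AdaptiveChernoff.
Variables (R : realType) (A : finType) (St : Type).
Variables (next : St -> A -> St) (cost : St -> A -> R).

Fixpoint total_cost (s : St) (l : seq A) : R :=
  if l is a :: l' then cost s a + total_cost (next s a) l' else 0.

Variables (q : A -> R) (inv : St -> Prop) (b : R).
Hypothesis q_ge0 : forall a, 0 <= q a.
Hypothesis inv_next : forall s a, inv s -> inv (next s a).
Hypothesis step : forall s, inv s -> \sum_a q a * expR (cost s a) <= b.

Lemma big_tuple_cons (n : nat) (F : n.+1.-tuple A -> R) :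
  \sum_(t : n.+1.-tuple A) F t =
  \sum_a \sum_(t : n.-tuple A) F [tuple of a :: t].
Proof.
rewrite pair_bigA /=.
rewrite (reindex (fun x : A * n.-tuple A => [tuple of x.1 :: x.2])) //=.
exists (fun t : n.+1.-tuple A => (thead t, [tuple of behead t])).
  by move=> [a t] _ /=; congr pair; apply/val_inj.
by move=> t _ /=; rewrite [RHS]tuple_eta; apply/val_inj.
Qed.

(** Supermartingale bound for letters drawn independently with weights [q]: the first letter is
    split off, and the induction hypothesis is applied at the state it leads to. The factor [b]
    holds uniformly over states satisfying [inv], hence whatever the past was. *)
Lemma expect_exp_total_cost (n : nat) (s : St) : inv s ->
  \sum_(t : n.-tuple A) (\prod_(a <- t) q a) * expR (total_cost s t) <= b ^+ n.
Proof.
elim: n s => [|n IH] s hs.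
  rewrite (big_pred1 [tuple]) => [|t]; last first.
    by apply/esym/eqP/val_inj; case: t => -[].
  by rewrite big_nil /= expR0 mul1r expr0.
have b0 : 0 <= b.
  by apply: le_trans (step hs); apply: sumr_ge0 => a _; rewrite mulr_ge0 // expR_ge0.
rewrite big_tuple_cons exprS.
apply: (@le_trans _ _ (\sum_a q a * expR (cost s a) * b ^+ n)); last first.
  by rewrite -mulr_suml ler_wpM2r ?exprn_ge0 // step.
apply: ler_sum => a _.
under eq_bigr => t _ do rewrite /= big_cons expRD mulrACA.
by rewrite -mulr_sumr ler_wpM2l ?mulr_ge0 ?expR_ge0 // IH //; exact: inv_next.
Qed.

End AdaptiveChernoff.

(* Points are absorbed one at a time into B - X X^T, after a shift of B by
   [dl], unless that would make tr (B^-1) exceed the value it had before the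
   shift.  By Markov's inequality each point is refused with small probability
   whatever the past was, so the refusals are dominated by a binomial law,
   while the absorbed points satisfy sum X X^T <= B_0 + n dl. *)
Section Barrier.
Variables (R : realType) (p : nat) (A : finType).
Variables (q : A -> R) (good : pred A) (r : A -> 'cV[R]_p).
Variables (dl phi beta : R).
Implicit Types (B : 'M[R]_p) (a : A).

(** The last two tests are sufficient conditions. The first of them keeps the downdated matrix
    positive definite. The other says that the increase of the potential under the downdate is paid
    for by its decrease under the shift. *)
Definition accept B a : bool :=
  let J := invmx (B + dl%:M) in
  [&& good a, dot (r a) (J *m r a) <= 2^-1 &
      2 * dot (r a) ((J *m J) *m r a) <= dl * \tr (J *m J)].

Definition barrier_next B a : 'M[R]_p :=
  if accept B a then B + dl%:M - r a *m (r a)^T else B + dl%:M.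

Definition barrier_inv B : Prop := posdef B /\ \tr (invmx B) <= phi.

Definition refusal B a : R := (~~ accept B a)%:R.

Hypothesis p_gt0 : (0 < p)%N.
Hypothesis dl_gt0 : 0 < dl.
Hypothesis q_ge0 : forall a, 0 <= q a.
Hypothesis second_moment_bound : forall M : 'M[R]_p, posdef M ->
  \sum_(a | good a) q a * dot (r a) (M *m r a) <= 4 * \tr M.
Hypothesis good_prob : \sum_(a | ~~ good a) q a <= beta.

Lemma posdef_sqr B : posdef B -> posdef (B *m B).
Proof.
move=> pB; split; first by rewrite trmx_mul pB.1.
move=> v v0; rewrite posdef_mulmx_sqr // dotvv_gt0 //; apply/eqP => Bv0.
by move/eqP: v0; apply; rewrite -(mulKmx (posdef_unit pB) v) Bv0 mulmx0.
Qed.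

Lemma posdef_trace_gt0 B : posdef B -> 0 < \tr B.
Proof.
move=> pB; rewrite trace_dot; pose k := Ordinal p_gt0.
rewrite (bigD1 k) //= ltr_pwDl //; last first.
  by apply: sumr_ge0 => i _; apply: posdef_ge0.
by apply: pB.2; rewrite -norm2_gt0 norm2_delta.
Qed.

Lemma barrier_inv_next B a : barrier_inv B -> barrier_inv (barrier_next B a).
Proof.
case=> pB trB; have pS := posdefD_scalar pB (ltW dl_gt0).
have := trace_inv_shift pB (ltW dl_gt0) => sh.
have t2 := posdef_trace_ge0 (posdef_sqr (posdef_inv pS)).
rewrite /barrier_next; case: ifPn => [/and3P[_ h1 h2]|_]; last first.
  split=> //; apply: le_trans trB; apply: le_trans sh.
  by rewrite lerDl mulr_ge0 // ltW.
split; first exact: posdef_downdate.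
apply: le_trans (trace_inv_downdate pS h1) _; apply: le_trans trB.
by apply: le_trans sh; rewrite lerD2l.
Qed.

(** For a good point the refusal indicator is at most 2 X + 2 Y / D, where X and Y are its quadratic
    forms in J and J^2 and D = dl tr (J^2). Averaging bounds the first term by 8 tr J <= 8 phi, and
    the second by 8 tr (J^2) / D = 8 / dl. *)
Lemma refusal_prob B : barrier_inv B ->
  \sum_a q a * refusal B a <= beta + 8 * phi + 8 / dl.
Proof.
case=> pB trB; have pS := posdefD_scalar pB (ltW dl_gt0).
have pJ := posdef_inv pS; have pJ2 := posdef_sqr pJ.
have t2 := posdef_trace_gt0 pJ2.
have trJ : \tr (invmx (B + dl%:M)) <= phi.
  apply: le_trans trB; apply: le_trans (trace_inv_shift pB (ltW dl_gt0)).
  by rewrite lerDl mulr_ge0 // ltW.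
set J := invmx (B + dl%:M) in pJ pJ2 t2 trJ *.
set D := dl * \tr (J *m J); have D0 : 0 < D by rewrite mulr_gt0.
rewrite (bigID good) /= addrC -addrA; apply: lerD.
  apply: le_trans good_prob; apply: ler_sum => a _.
  by rewrite ler_piMr // /refusal; case: (~~ _).
apply: (@le_trans _ _ (\sum_(a | good a) (2 * (q a * dot (r a) (J *m r a)) +
    2 / D * (q a * dot (r a) ((J *m J) *m r a))))).
  apply: ler_sum => a ga.
  have x0 := posdef_ge0 (r a) pJ; have y0 := posdef_ge0 (r a) pJ2.
  have -> : 2 * (q a * dot (r a) (J *m r a)) +
      2 / D * (q a * dot (r a) ((J *m J) *m r a)) =
    q a * (2 * dot (r a) (J *m r a) + 2 * dot (r a) ((J *m J) *m r a) / D).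
    by ring.
  apply: ler_wpM2l => //; rewrite /refusal /accept ga /= -/J -/D.
  set X := dot _ _ in x0 *; set Y := dot _ _ in y0 *.
  have Y0 : 0 <= 2 * Y / D by rewrite !mulr_ge0 // invr_ge0 ltW.
  have [hX|hX] := leP X 2^-1; have [hY|hY] := leP (2 * Y) D; rewrite /=; try lra.
  have : 1 < 2 * Y / D by rewrite ltr_pdivlMr // mul1r.
  by lra.
rewrite big_split /= -!mulr_sumr.
have h1 := second_moment_bound pJ; have h2 := second_moment_bound pJ2.
apply: lerD; first by lra.
apply: (@le_trans _ _ (2 / D * (4 * \tr (J *m J)))).
  by rewrite ler_wpM2l // divr_ge0 // ltW.
rewrite le_eqVlt; apply/orP; left; apply/eqP; rewrite /D; field.
by rewrite !gt_eqF.
Qed.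

(** The mask [m] marks the absorbed points. Along the run, v^T B v gains dl |v|^2 per point and
    loses (r a . v)^2 per absorbed point. It is nonnegative at the end because the invariant keeps
    the matrix positive definite. *)
Lemma barrier_accepted (a0 : A) B (s : seq A) : barrier_inv B ->
  exists m : seq bool,
    [/\ size m = size s,
        (count negb m)%:R = total_cost barrier_next refusal B s,
        forall i, nth false m i -> good (nth a0 s i) &
        forall v, \sum_(0 <= i < size s | nth false m i)
                     dot (r (nth a0 s i)) v ^+ 2
          <= dot v (B *m v) + (size s)%:R * dl * dot v v].
Proof.
elim: s B => [|a s IH] B iB.
  exists [::]; split=> // [i|v]; rewrite ?nth_nil // big_geq // !mul0r addr0.
  by apply: posdef_ge0; case: iB.
have [m [sm cm gm hm]] := IH _ (barrier_inv_next a iB).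
exists (accept B a :: m); split=> [|||v] /=; first by rewrite sm.
- by rewrite natrD cm.
- by case=> [/and3P[]|i /gm].
rewrite big_mkcond /= big_nat_recl //= -big_mkcond /=.
rewrite [X in _ <= _ + X * _ * _]mulrS !mulrDl mul1r addrA.
have := hm v; rewrite /barrier_next.
case: (accept B a); rewrite ?mulmxBl mulmxDl ?dotBr dotDr dot_scalar.
  by rewrite dot_outer -expr2; lra.
by lra.
Qed.

End Barrier.

(** * From i.i.d. observables to finite product laws *)

Section FiniteObservables.
Context {R : realType} {d dE : measure_display}.
Context {Omega : measurableType d} {E : measurableType dE}.
Variable P : probability Omega R.

Lemma measure_bigsetU_le (I : Type) (l : seq I) (Q : pred I) (F : I -> set Omega) :
  (forall i, measurable (F i)) ->
  (P (\big[setU/set0]_(i <- l | Q i) F i) <= \sum_(i <- l | Q i) P (F i))%E.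
Proof.
move=> mF; elim: l => [|i l IH]; first by rewrite !big_nil measure0.
rewrite !big_cons; case: (Q i) => //.
apply: le_trans (measureU2 _ _ _) _ => //; last exact: leeD2l.
by apply: bigsetU_measurable.
Qed.

Variables (n : nat) (obs : 'I_n -> Omega -> E).
Hypothesis mobs : forall i, measurable_fun setT (obs i).
Hypothesis obs_id : forall i j (B : set E), measurable B ->
  P (obs i @^-1` B) = P (obs j @^-1` B).
Hypothesis obs_indep : forall B : 'I_n -> set E, (forall i, measurable (B i)) ->
  P (\bigcap_i (obs i @^-1` B i)) = (\prod_(i < n) P (obs i @^-1` B i))%E.

Variables (A : finType) (g : E -> A).
Hypothesis mg : forall a, measurable (g @^-1` [set a]).

Definition law (i : 'I_n) (a : A) : R := fine (P (obs i @^-1` (g @^-1` [set a]))).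

Definition sample (w : Omega) : n.-tuple A := [tuple g (obs i w) | i < n].

Lemma measurable_fiber i a : measurable (obs i @^-1` (g @^-1` [set a])).
Proof. by rewrite -[X in measurable X]setTI; apply: mobs. Qed.

Lemma law_ge0 i a : 0 <= law i a.
Proof. exact/fine_ge0. Qed.

Lemma lawE i a : (law i a)%:E = P (obs i @^-1` (g @^-1` [set a])).
Proof. by rewrite fineK // fin_num_measure //; exact: measurable_fiber. Qed.

Lemma law_expect i (F : A -> R) : (forall a, 0 <= F a) ->
  (\int[P]_w (F (g (obs i w)))%:E = (\sum_a law i a * F a)%:E)%E.
Proof.
move=> F0.
transitivity (\int[P]_w \sum_a ((F a)%:E *
    (\1_(obs i @^-1` (g @^-1` [set a])) w)%:E))%E.
  apply: eq_integral => w _; rewrite (bigD1 (g (obs i w))) //=.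
  rewrite big1 => [|a /negPf ag]; rewrite indicE.
    by rewrite mem_set //= mule1 adde0.
  rewrite memNset ?mule0 //= => /eqP; by rewrite eq_sym ag.
have mi a : measurable_fun setT
    (EFin \o (\1_(obs i @^-1` (g @^-1` [set a])) : Omega -> R)).
  by apply/measurable_EFinP; apply: measurable_indic; exact: measurable_fiber.
rewrite ge0_integral_sum //; last 2 first.
- by move=> a; apply: measurable_funeM; exact: mi.
- by move=> a w _; rewrite -EFinM lee_fin mulr_ge0.
rewrite -sumEFin; apply: eq_bigr => a _.
rewrite ge0_integralZl //; last 2 first.
- exact: mi.
- by rewrite lee_fin.
rewrite integral_indic ?setIT //; last exact: measurable_fiber.
by rewrite mulrC EFinM lawE.
Qed.

Lemma law_sum1 i : \sum_a law i a = 1.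
Proof.
apply: EFin_inj; transitivity (\int[P]_w 1%:E)%E.
  rewrite (@law_expect i (fun=> 1)) //.
  by congr EFin; apply: eq_bigr => a _; rewrite mulr1.
by rewrite integral_cst // mul1e; exact: probability_setT.
Qed.

Lemma sample_eq (t : n.-tuple A) :
  [set w | sample w = t] =
  \bigcap_i (obs i @^-1` (g @^-1` [set tnth t i])).
Proof.
apply/seteqP; split=> w /=; first by move=> <- i _ /=; rewrite tnth_mktuple.
by move=> h; apply: eq_from_tnth => i; rewrite tnth_mktuple; apply: h.
Qed.

Lemma measurable_sample_eq (t : n.-tuple A) : measurable [set w | sample w = t].
Proof.
rewrite sample_eq; apply: fin_bigcap_measurable => // i _.
exact: measurable_fiber.
Qed.

Lemma sample_event (Q : pred (n.-tuple A)) :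
  [set w | Q (sample w)] = \big[setU/set0]_(t | Q t) [set w | sample w = t].
Proof.
rewrite -bigcup_seq_cond; apply/seteqP; split=> w /=.
  by move=> Qs; exists (sample w) => //=; rewrite mem_index_enum.
by case=> t /= /andP[_ Qt] ->.
Qed.

Lemma measurable_sample_event (Q : pred (n.-tuple A)) :
  measurable [set w | Q (sample w)].
Proof.
rewrite sample_event; apply: bigsetU_measurable => t _.
exact: measurable_sample_eq.
Qed.

(** Independence and equality in law turn the probability of each atom into a product of values of
    the law at [i0]; a union bound over the atoms of [Q] does the rest. *)
Lemma sample_prob_le (i0 : 'I_n) (Q : pred (n.-tuple A)) :
  (P [set w | Q (sample w)]
     <= (\sum_(t : n.-tuple A | Q t) \prod_(a <- t) law i0 a)%:E)%E.
Proof.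
rewrite sample_event -sumEFin.
apply: le_trans (measure_bigsetU_le _ _ _) _; first exact: measurable_sample_eq.
apply: lee_sum => t _; rewrite sample_eq obs_indep => [|i]; last exact: mg.
rewrite big_tuple -prodEFin le_eqVlt; apply/orP; left; apply/eqP.
by apply: eq_bigr => i _; rewrite (obs_id i i0 (mg _)) -lawE.
Qed.

(** Exponential Markov inequality: each tuple in [Q] may be weighted by exp(total cost - thr) >=
    1. *)
Lemma adaptive_tail (i0 : 'I_n) (St : Type) (next : St -> A -> St)
    (cost : St -> A -> R) (inv : St -> Prop) (b thr : R) (s0 : St)
    (Q : pred (n.-tuple A)) :
  (forall s a, inv s -> inv (next s a)) ->
  (forall s, inv s -> \sum_a law i0 a * expR (cost s a) <= b) ->
  inv s0 -> (forall t, Q t -> thr <= total_cost next cost s0 t) ->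
  (P [set w | Q (sample w)] <= (b ^+ n * expR (- thr))%:E)%E.
Proof.
move=> inv_next step inv0 Qthr; apply: le_trans (sample_prob_le i0 Q) _.
rewrite lee_fin.
have pr0 (t : n.-tuple A) : 0 <= \prod_(a <- t) law i0 a.
  by apply: prodr_ge0 => a _; exact: law_ge0.
have := expect_exp_total_cost (law_ge0 i0) inv_next step n inv0.
move=> /(ler_wpM2r (expR_ge0 (- thr))); apply: le_trans.
rewrite mulr_suml [leRHS](bigID Q) /= -[leLHS]addr0; apply: lerD.
  apply: ler_sum => t Qt; rewrite -mulrA ler_peMr // -expRD -expR0.
  by rewrite ler_expR subr_ge0 Qthr.
by apply: sumr_ge0 => t _; rewrite !mulr_ge0 ?expR_ge0.
Qed.

End FiniteObservables.

Lemma expR_half_le2 (R : realType) : expR (2^-1 : R) <= 2.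
Proof.
have := @expR_ge1Dx R (- 2^-1); rewrite expRN => h.
rewrite -[leLHS]invrK -[leRHS]invrK lef_pV2 ?posrE ?invr_gt0 ?expR_gt0 //.
by lra.
Qed.

Lemma total_costZ (R : realType) (A : finType) (St : Type)
    (next : St -> A -> St) (cost : St -> A -> R) (c : R) s l :
  total_cost next (fun s a => c * cost s a) s l = c * total_cost next cost s l.
Proof.
by elim: l s => [|a l IH] s /=; rewrite ?mulr0 // IH mulrDr.
Qed.

(** * Chernoff bounds for adaptive counts and for counts of independent events *)

Section Tails.
Context {R : realType} {d dE : measure_display}.
Context {Omega : measurableType d} {E : measurableType dE}.
Variables (P : probability Omega R) (n : nat) (obs : 'I_n -> Omega -> E).
Hypothesis mobs : forall i, measurable_fun setT (obs i).
Hypothesis obs_id : forall i j (B : set E), measurable B ->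
  P (obs i @^-1` B) = P (obs j @^-1` B).
Hypothesis obs_indep : forall B : 'I_n -> set E, (forall i, measurable (B i)) ->
  P (\bigcap_i (obs i @^-1` B i)) = (\prod_(i < n) P (obs i @^-1` B i))%E.

(** Chernoff bound with parameter 1/2: since exp(1/2) <= 2, a cost f in {0, 1} satisfies exp(f / 2)
    <= 1 + f, whose mean is at most 1 + rho <= exp(rho). *)
Lemma adaptive_count_tail (A : finType) (g : E -> A) (i0 : 'I_n) (St : Type)
    (next : St -> A -> St) (f : St -> A -> bool) (inv : St -> Prop)
    (rho thr : R) (s0 : St) (Q : pred (n.-tuple A)) :
  (forall a, measurable (g @^-1` [set a])) ->
  (forall s a, inv s -> inv (next s a)) ->
  (forall s, inv s -> \sum_a law P obs g i0 a * (f s a)%:R <= rho) ->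
  inv s0 ->
  (forall t, Q t -> thr <= total_cost next (fun s a => (f s a)%:R) s0 t) ->
  (P [set w | Q (sample obs g w)] <= (expR (rho * n%:R - thr / 2))%:E)%E.
Proof.
move=> mg inv_next step inv0 Qthr.
have := @adaptive_tail R _ _ _ _ P n obs mobs obs_id obs_indep A g mg i0 St next
  (fun s a => 2^-1 * (f s a)%:R) inv (expR rho) (2^-1 * thr) s0 Q inv_next.
have -> : expR rho ^+ n * expR (- (2^-1 * thr)) = expR (rho * n%:R - thr / 2).
  by rewrite -expRM_natr expRD mulrC (mulrC 2^-1) mulrC.
apply => // [s invs|t Qt]; last by rewrite total_costZ ler_wpM2l ?Qthr.
apply: (@le_trans _ _ (\sum_a (law P obs g i0 a + law P obs g i0 a * (f s a)%:R))).
  apply: ler_sum => a _; rewrite -[X in X + _]mulr1 -mulrDr.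
  rewrite ler_wpM2l ?law_ge0 //; case: (f s a).
    by rewrite mulr1 expR_half_le2.
  by rewrite mulr0 expR0 addr0.
rewrite big_split /= law_sum1 //; apply: le_trans (expR_ge1Dx _).
by rewrite lerD2l step.
Qed.

Lemma measurable_bool_fiber (D : E -> bool) b : measurable [set e | D e] ->
  measurable (D @^-1` [set b]).
Proof.
move=> mD; case: b.
  by have -> : D @^-1` [set true] = [set e | D e] by apply/seteqP; split.
have -> : D @^-1` [set false] = ~` [set e | D e].
  by apply/seteqP; split=> e /=; [move=> -> | move/negP/negbTE].
exact: measurableC.
Qed.

Lemma law_true (D : E -> bool) (i : 'I_n) : measurable [set e | D e] ->
  (law P obs D i true)%:E = P (obs i @^-1` [set e | D e]).
Proof.
move=> mD; rewrite lawE // => b; exact: measurable_bool_fiber.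
Qed.

Lemma total_cost_unit (h : bool -> R) (l : seq bool) s :
  total_cost (fun (s : unit) _ => s) (fun _ b => h b) s l = \sum_(b <- l) h b.
Proof. by elim: l s => [|b l IH] s /=; rewrite ?big_nil // big_cons IH. Qed.

Lemma sum_sample (D : E -> bool) w :
  \sum_(b <- sample obs D w) b%:R = \sum_(i < n) (D (obs i w))%:R :> R.
Proof. by rewrite big_tuple; apply: eq_bigr => i _; rewrite tnth_mktuple. Qed.

Lemma measurable_count (D : E -> bool) (Q : pred R) :
  measurable [set e | D e] ->
  measurable [set w | Q (\sum_(i < n) (D (obs i w))%:R)].
Proof.
move=> mD; pose Q' (t : n.-tuple bool) := Q (\sum_(b <- t) b%:R).
have -> : [set w | Q (\sum_(i < n) (D (obs i w))%:R)] =
    [set w | Q' (sample obs D w)].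
  by apply/seteqP; split=> w /=; rewrite /Q' sum_sample.
by apply: measurable_sample_event => // b; exact: measurable_bool_fiber.
Qed.

(** A one-state instance of the adaptive bound with rho = t / 4; the exponent is t / 4 - t / 2 per
    draw. *)
Lemma count_upper_tail (D : E -> bool) (i0 : 'I_n) (t : R) :
  measurable [set e | D e] ->
  (P (obs i0 @^-1` [set e | D e]) <= (t / 4)%:E)%E ->
  (P [set w | (t * n%:R <= \sum_(i < n) (D (obs i w))%:R)%R]
    <= (expR (- (t / 4 * n%:R)))%:E)%E.
Proof.
move=> mD PD.
pose Q (s : n.-tuple bool) := t * n%:R <= \sum_(b <- s) b%:R :> R.
have -> : [set w | t * n%:R <= \sum_(i < n) (D (obs i w))%:R] =
    [set w | Q (sample obs D w)].
  by apply/seteqP; split=> w /=; rewrite /Q sum_sample.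
have := @adaptive_count_tail bool D i0 unit (fun s _ => s) (fun _ b => b)
  (fun=> True) (t / 4) (t * n%:R) tt Q (fun b => measurable_bool_fiber b mD).
have -> : t / 4 * n%:R - t * n%:R / 2 = - (t / 4 * n%:R) :> R by field.
apply => // [s _|s Qs].
  by rewrite big_bool /= mulr1 mulr0 addr0 -lee_fin law_true.
by rewrite (total_cost_unit (fun b => b%:R)).
Qed.

(** Chernoff bound with parameter -1. As exp(-1) <= 1/2, each draw has exponential moment at most 1
    - q / 2 <= exp(- q / 2); the threshold q / 4 gives back half of this exponent. *)
Lemma count_lower_tail (D : E -> bool) (i0 : 'I_n) (q : R) :
  measurable [set e | D e] ->
  (q%:E <= P (obs i0 @^-1` [set e | D e]))%E ->
  (P [set w | (\sum_(i < n) (D (obs i w))%:R <= q / 4 * n%:R)%R]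
    <= (expR (- (q / 4 * n%:R)))%:E)%E.
Proof.
move=> mD PD.
pose Q (s : n.-tuple bool) := \sum_(b <- s) b%:R <= q / 4 * n%:R :> R.
have -> : [set w | \sum_(i < n) (D (obs i w))%:R <= q / 4 * n%:R] =
    [set w | Q (sample obs D w)].
  by apply/seteqP; split=> w /=; rewrite /Q sum_sample.
have := @adaptive_tail R _ _ _ _ P n obs mobs obs_id obs_indep bool D
  (fun b => measurable_bool_fiber b mD) i0 unit (fun s _ => s) (fun _ b => - b%:R)
  (fun=> True) (expR (- (q / 2))) (- (q / 4 * n%:R)) tt Q.
have -> : expR (- (q / 2)) ^+ n * expR (- - (q / 4 * n%:R)) =
    expR (- (q / 4 * n%:R)) :> R.
  by rewrite -expRM_natr -expRD; congr expR; field.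
apply => // [s _|s Qs]; last first.
  by rewrite (total_cost_unit (fun b => - b%:R)) sumrN lerN2.
have := law_sum1 P mobs (fun b => measurable_bool_fiber b mD) i0.
rewrite !big_bool /= oppr0 expR0 mulr1.
have : q <= law P obs D i0 true by rewrite -lee_fin law_true.
have e1 : expR (-1) <= 2^-1 :> R.
  rewrite expRN lef_pV2 ?posrE ?expR_gt0 //.
  by have := @expR_ge1Dx R 1; lra.
have := @expR_ge1Dx R (- (q / 2)).
have := law_ge0 P obs D i0 true.
move: (law _ _ _ _ true) (law _ _ _ _ false) => lt lf; nra.
Qed.

End Tails.

(** * Moments and small balls *)

Lemma expr4E (R : pzRingType) (t : R) : t ^+ 4 = (t ^+ 2) ^+ 2.
Proof. by rewrite -exprM. Qed.

Section Moments.
Context {R : realType} {d : measure_display} {Omega : measurableType d}.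
Variable P : probability Omega R.

Lemma measurable_le_fun (f : Omega -> R) (t : R) : measurable_fun setT f ->
  measurable [set w | t <= f w].
Proof.
move=> mf; rewrite -[X in measurable X]setTI.
have -> : [set w | t <= f w] = f @^-1` `[t, +oo[.
  by apply/seteqP; split=> w /=; rewrite in_itv /= andbT.
exact: mf.
Qed.

Lemma measurable_abs (f : Omega -> R) : measurable_fun setT f ->
  measurable_fun setT (fun w => `|f w|).
Proof.
by move=> mf; apply: measurableT_comp => //; exact: measurable_realfun.normr_measurable.
Qed.

Lemma measurable_indicE (D : set Omega) : measurable D ->
  measurable_fun setT (fun w => (\1_D w : R)).
Proof. by move=> mD; apply: measurable_indic. Qed.

Lemma prob_markov (f : Omega -> R) (m t : R) : measurable_fun setT f ->
  (forall w, 0 <= f w) -> 0 < t -> (\int[P]_w (f w)%:E <= m%:E)%E ->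
  (P [set w | (t <= f w)%R] <= (m / t)%:E)%E.
Proof.
move=> mf f0 t0 fm.
have mD := measurable_le_fun t mf; set D := [set w | _] in mD *.
rewrite EFinM lee_pdivlMr // muleC; apply: le_trans fm.
have -> : (t%:E * P D = \int[P]_w (t * \1_D w)%:E)%E.
  under eq_integral do rewrite EFinM.
  rewrite ge0_integralZl //.
  - by rewrite integral_indic // setIT.
  - by apply/measurable_EFinP; exact: measurable_indicE.
  - by rewrite lee_fin ltW.
apply: ge0_le_integral => //.
- by move=> w _; rewrite lee_fin mulr_ge0 // ltW.
- by apply/measurable_EFinP; apply: measurable_funM => //; exact: measurable_indicE.
- exact/measurable_EFinP.
- move=> w _; rewrite lee_fin indicE.
  case: (boolP (w \in D)) => [|_]; last by rewrite mulr0.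
  by rewrite mulr1 => /set_mem.
Qed.

(** Markov's inequality if [kappa] is positive. If [kappa] = 0, then f vanishes almost everywhere,
    and it is the strictness of the inequality that makes the event negligible. *)
Lemma prob_gt_scaled_mean (f : Omega -> R) (kappa M : R) :
  measurable_fun setT f -> 0 < M ->
  (\int[P]_w (`|f w|)%:E = kappa%:E)%E ->
  (P [set w | (M * kappa < `|f w|)%R] <= (M^-1)%:E)%E.
Proof.
move=> mf M0 fk.
have mnf := measurable_abs mf.
have k0 : 0 <= kappa by rewrite -lee_fin -fk; apply: integral_ge0.
have mgt : measurable [set w | M * kappa < `|f w|].
  rewrite -[X in measurable X]setTI.
  have -> : [set w | M * kappa < `|f w|] = (fun w => `|f w|) @^-1` `]M * kappa, +oo[.
    by apply/seteqP; split=> w /=; rewrite in_itv /= andbT.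
  exact: mnf.
move: k0; rewrite le_eqVlt => /predU1P[kE|kpos]; last first.
  have Mk : 0 < M * kappa by rewrite mulr_gt0.
  have := prob_markov mnf (fun w => normr_ge0 _) Mk.
  rewrite fk => /(_ _ (lexx _)).
  have -> : kappa / (M * kappa) = M^-1 by field; rewrite !gt_eqF.
  apply: le_trans; apply: le_measure; rewrite ?inE //.
    exact: measurable_le_fun.
  by move=> w /= /ltW.
have mE : measurable_fun setT (EFin \o f) by exact/measurable_EFinP.
have [ae0 _] := @ae_eq_integral_abs _ _ _ P setT measurableT _ mE.
have /ae0 : (\int[P]_(x in setT) `|(EFin \o f) x| = 0)%E by rewrite -[RHS]/(0%:E) kE -fk.
move=> h; rewrite -kE in mgt *.
have -> : P [set w | (M * 0 < `|f w|)%R] = 0%E.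
  apply/negligibleP => //; case: h => N [mN N0 sub].
  exists N; split=> // w /=; rewrite mulr0 normr_gt0 => fw; apply: sub => /= h.
  by have := h I; case=> fw0; rewrite fw0 eqxx in fw.
by rewrite lee_fin invr_ge0 ltW.
Qed.

Variables (p : nat) (X : Omega -> 'cV[R]_p).
Hypothesis mX : forall k, measurable_fun setT (fun w => X w k 0).

Lemma measurable_dot v : measurable_fun setT (fun w => dot v (X w)).
Proof. by apply: measurable_sum => k; apply: measurable_funM. Qed.

Hypothesis X_iso : second_moment_id P X.

Lemma second_moment_entry k l :
  (\int[P]_w (X w k 0 * X w l 0)%:E = ((k == l)%:R)%:E)%E.
Proof.
have := X_iso k l; rewrite unlock !mxE => <-.
by apply: eq_integral => w _; rewrite mxE big_ord1 mxE.
Qed.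

(** Domination by the sum of the two squares, which are integrable by isotropy. *)
Lemma integrable_prod k l :
  P.-integrable setT (fun w => (X w k 0 * X w l 0)%:E).
Proof.
have sq j : P.-integrable setT (fun w => (X w j 0 * X w j 0)%:E).
  apply/integrableP; split.
    by apply/measurable_EFinP; apply: measurable_funM.
  have := second_moment_entry j j; rewrite eqxx => h.
  rewrite (_ : (\int[P]_w _)%E = 1%:E) ?ltry // -[RHS]h.
  by apply: eq_integral => w _; rewrite abse_EFin ger0_norm // -expr2 sqr_ge0.
apply: (@le_integrable _ _ _ P setT _ _
  (fun w => ((X w k 0 * X w k 0)%:E + (X w l 0 * X w l 0)%:E)%E)) => //.
- by apply/measurable_EFinP; apply: measurable_funM.
- move=> w _; rewrite -EFinD !abse_EFin lee_fin.
  rewrite [leRHS]ger0_norm; last by rewrite addr_ge0 // -expr2 sqr_ge0.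
  by rewrite ler_norml; apply/andP; split; nra.
- exact: integrableD.
Qed.

Lemma quad_expect (M : 'M[R]_p) :
  (\int[P]_w (dot (X w) (M *m X w))%:E = (\tr M)%:E)%E.
Proof.
transitivity (\int[P]_w (\sum_k \sum_l ((M k l)%:E * (X w k 0 * X w l 0)%:E)))%E.
  apply: eq_integral => w _; rewrite /dot -sumEFin; apply: eq_bigr => k _.
  rewrite mxE mulr_sumr -sumEFin; apply: eq_bigr => l _.
  by rewrite -EFinM; congr EFin; ring.
have iM k l : P.-integrable setT (fun w => ((M k l)%:E * (X w k 0 * X w l 0)%:E)%E).
  exact: (integrableZl measurableT _ (integrable_prod k l)).
rewrite integral_sum //; last first.
  by move=> k; apply: (integrable_sum measurableT) => l _; exact: iM.
rewrite /mxtrace -sumEFin; apply: eq_bigr => k _.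
rewrite integral_sum // (bigD1 k) //= big1 ?adde0 => [|l /negPf lk].
  rewrite (integralZl measurableT (integrable_prod k k)).
  by rewrite second_moment_entry eqxx mule1.
rewrite (integralZl measurableT (integrable_prod k l)) second_moment_entry.
by rewrite eq_sym lk mule0.
Qed.

Lemma dot_sqr_expect v : (\int[P]_w (dot v (X w) ^+ 2)%:E = (dot v v)%:E)%E.
Proof.
have := quad_expect (v *m v^T).
rewrite mxtrace_mulC /mxtrace big_ord1 -dotE => <-.
by apply: eq_integral => w _; rewrite dot_outer expr2.
Qed.

Lemma fourth_moment_le (s C : R) v : hypercontractive42 P X s -> s <= C ->
  norm2 v = 1 -> (\int[P]_w (dot v (X w) ^+ 4)%:E <= (C ^+ 4)%:E)%E.
Proof.
move=> hyp sC v1; have := hyp v v1; rewrite unlock.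
have -> : (\int[P]_w ((`|dot v (X w)| ^+ 4)%R)%:E = \int[P]_w (dot v (X w) ^+ 4)%:E)%E.
  apply: eq_integral => w _; congr EFin.
  by rewrite !expr4E real_normK ?num_real.
rewrite dot_sqr_expect -sqr_norm2 v1 expr1n poweR_EFin powR1 mule1.
set e4 := (\int[P]_w _)%E => h.
have e4_0 : (0 <= e4)%E.
  by apply: integral_ge0 => w _; rewrite lee_fin expr4E sqr_ge0.
have hC : (e4 `^ 4^-1 <= C%:E)%E by apply: le_trans h _; rewrite lee_fin.
have C0 : 0 <= C by rewrite -lee_fin; apply: le_trans hC; exact: poweR_ge0.
(* Powers are taken in the extended reals because [e4] is not yet known to be finite. *)
have -> : e4 = ((e4 `^ 4^-1) `^ 4)%E.
  by rewrite -poweRrM mulVf ?poweRe1 // pnatr_eq0.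
have -> : (C ^+ 4)%:E = (C%:E `^ 4)%E by rewrite poweR_EFin powR_mulrn.
by apply: gt0_ler_poweR => //; rewrite in_itv /= leey andbT ?poweR_ge0 ?lee_fin.
Qed.

(** With K = C^4 and t = v . X, pointwise t^2 <= 1/4 + t^4 / (2 K) + (K / 2) 1_D, where D is the
    event |t| >= 1/2. Integrating gives 1 <= 1/4 + 1/2 + (K / 2) P(D), hence the bound on P(D). *)
Lemma small_ball (s C : R) v : hypercontractive42 P X s -> s <= C -> 0 < C ->
  norm2 v = 1 ->
  ((2 * C ^+ 4)^-1%:E <= P [set w | (2^-1 <= `|dot v (X w)|)%R])%E.
Proof.
move=> hyp sC C0 v1; set K := C ^+ 4.
have K0 : 0 < K by rewrite exprn_gt0.
have mv := measurable_dot v.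
have mD : measurable [set w | 2^-1 <= `|dot v (X w)|].
  by apply: measurable_le_fun; exact: measurable_abs.
set D := [set w | _] in mD *.
have m4 : measurable_fun setT (fun w => (2 * K)^-1 * dot v (X w) ^+ 4).
  by apply: measurable_funM => //; apply: measurable_funX.
have mI : measurable_fun setT (fun w => K / 2 * (\1_D w)).
  by apply: measurable_funM => //; exact: measurable_indicE.
have e4 := fourth_moment_le hyp sC v1.
have : ((1 : R)%:E <= (4^-1)%:E + (2 * K)^-1%:E * (K%:E) + (K / 2)%:E * P D)%E.
  have -> : 1%:E = (\int[P]_w (dot v (X w) ^+ 2)%:E)%E.
    by rewrite dot_sqr_expect -sqr_norm2 v1 expr1n.
  apply: (@le_trans _ _ (\int[P]_w ((4^-1)%:E +
    ((2 * K)^-1 * dot v (X w) ^+ 4)%:E + (K / 2 * \1_D w)%:E))%E).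
    apply: ge0_le_integral => //.
    - by move=> w _; rewrite lee_fin sqr_ge0.
    - by apply/measurable_EFinP; apply: measurable_funX.
    - apply/measurable_EFinP; apply: measurable_funD => //.
      by apply: measurable_funD.
    - move=> w _; rewrite -!EFinD lee_fin indicE.
      set t := dot v (X w).
      have t4 := expr4E t.
      have t2 : 0 <= t ^+ 2 := sqr_ge0 t.
      case: (boolP (w \in D)) => [_|/negP wD].
        rewrite mulr1 -subr_ge0.
        (* On D the inequality is t^2 <= t^4 / (2 K) + K / 2, by completing the square. *)
        have -> : 4^-1 + (2 * K)^-1 * t ^+ 4 + K / 2 - t ^+ 2 =
          4^-1 + (t ^+ 2 - K) ^+ 2 / (2 * K).
          by rewrite t4; field; rewrite gt_eqF.
        by rewrite addr_ge0 // divr_ge0 ?sqr_ge0 // mulr_ge0 // ltW.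
      have : `|t| < 2^-1.
        by rewrite ltNge; apply/negP => h; apply: wD; rewrite inE.
      move=> ht; rewrite mulr0 addr0.
      have : t ^+ 2 <= 4^-1.
        rewrite -[t ^+ 2]real_normK ?num_real //.
        by have := normr_ge0 t; nra.
      move=> h; apply: le_trans h _; rewrite lerDl mulr_ge0 ?t4 ?sqr_ge0 //.
      by rewrite invr_ge0 mulr_ge0 // ltW.
  rewrite ge0_integralD //; last 4 first.
  - move=> w _; rewrite -EFinD lee_fin addr_ge0 // mulr_ge0 //.
      by rewrite invr_ge0 mulr_ge0 // ltW.
    by rewrite expr4E sqr_ge0.
  - by apply/measurable_EFinP; apply: measurable_funD.
  - by move=> w _; rewrite lee_fin mulr_ge0 // divr_ge0 // ltW.
  - exact/measurable_EFinP.
  rewrite ge0_integralD //; last 2 first.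
  - move=> w _; rewrite lee_fin mulr_ge0 //.
      by rewrite invr_ge0 mulr_ge0 // ltW.
    by rewrite expr4E sqr_ge0.
  - exact/measurable_EFinP.
  apply: leeD; first apply: leeD.
  - by rewrite integral_cst // [X in (_ * X)%E](probability_setT P) mule1.
  - under eq_integral do rewrite EFinM.
    rewrite ge0_integralZl //.
    + by rewrite lee_wpmul2l // lee_fin invr_ge0 mulr_ge0 // ltW.
    + by apply/measurable_EFinP; apply: measurable_funX.
    + by move=> w _; rewrite lee_fin expr4E sqr_ge0.
    + by rewrite lee_fin invr_ge0 mulr_ge0 // ltW.
  - under eq_integral do rewrite EFinM.
    rewrite ge0_integralZl //.
    + by rewrite integral_indic // setIT.
    + by apply/measurable_EFinP; exact: measurable_indicE.
    + by rewrite lee_fin divr_ge0 // ltW.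
have : P D \is a fin_num by apply: fin_num_measure.
case: (P D) => // r _.
rewrite -!EFinM -!EFinD !lee_fin => h.
have h2 : (2 * K)^-1 * K = 2^-1 by field; rewrite gt_eqF.
rewrite h2 in h; rewrite -[(2 * K)^-1]mul1r ler_pdivrMr ?mulr_gt0 //.
by nra.
Qed.

End Moments.

(** * Corruptions as matchings *)

Section Matching.
Variables (R : realType) (n : nat).

(** Replaces a multiset intersection by a matching of indices. Suitable permutations of the indices
    of [T] and of [S] both list the intersection first; [s] sends an index of [T] to the index of
    [S] at the same position. *)
Lemma corrupted_matching (K : choiceType) (S T : 'I_n -> K) (eps : R) :
  corrupted eps S T ->
  exists2 s : 'I_n -> 'I_n, injective s &
    (1 - eps) * n%:R <= #|[set i | T i == S (s i)]%SET|%:R.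
Proof.
rewrite /corrupted; set I := (_ `&` _)%mset => cor.
have split_off (U : 'I_n -> K) : (forall x, I x <= count_mem x (codom U))%N ->
    exists p : {perm 'I_n}, forall i : 'I_n, (i < size I)%N ->
      forall x0, U (p i) = nth x0 I i.
  move=> le_IU; pose J := (seq_mset (codom U) `\` I)%mset.
  have : perm_eq ((I : seq K) ++ (J : seq K)) [tuple U i | i < n].
    have -> : tval [tuple U i | i < n] = codom U by rewrite codomE /= enumT.
    apply/eq_seq_msetP/msetP => x.
    rewrite !mset_seqE count_cat !count_mem_mset.
    have -> : J x = (count_mem x (codom U) - I x)%N by rewrite msetE2 mset_seqE.
    by rewrite subnKC.
  move=> /tuple_permP[p pE]; exists p => i iI x0.
  have := congr1 (fun s => nth x0 s i) pE.
  rewrite nth_cat iI => ->.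
  by rewrite -tnth_nth !tnth_mktuple.
have [p pT] : exists p : {perm 'I_n}, forall i : 'I_n, (i < size I)%N ->
    forall x0, T (p i) = nth x0 I i.
  by apply: split_off => x; rewrite /I msetE2 !mset_seqE geq_minl.
have [q qS] : exists q : {perm 'I_n}, forall i : 'I_n, (i < size I)%N ->
    forall x0, S (q i) = nth x0 I i.
  by apply: split_off => x; rewrite /I msetE2 !mset_seqE geq_minr.
have sIn : (size I <= n)%N.
  rewrite -[X in (_ <= X)%N](card_ord n) -(size_codom T).
  have /count_subseqP[s ss /perm_size ->] :
      forall x, (count_mem x I <= count_mem x (codom T))%N.
    by move=> x; rewrite count_mem_mset msetE2 !mset_seqE geq_minl.
  exact: size_subseq.
exists (fun i => q ((p^-1)%g i)).
  by move=> i j /perm_inj/perm_inj.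
apply: le_trans cor _; rewrite ler_nat -/I.
apply: (@leq_trans #|p @: [set i : 'I_n | (i < size I)%N]%SET|).
  rewrite card_imset; last exact: perm_inj.
  have -> : [set i : 'I_n | (i < size I)%N]%SET = widen_ord sIn @: [set: 'I_(size I)]%SET.
    apply/setP => i; rewrite inE; apply/idP/imsetP => [iI|[j _ ->]] //=.
    by exists (Ordinal iI); rewrite ?inE //; apply/val_inj.
  rewrite card_imset ?cardsT ?card_ord //.
  by move=> i j /(congr1 val) /= ij; apply/val_inj.
apply/subset_leq_card/fintype.subsetP => j /imsetP[i]; rewrite inE => iI ->.
by rewrite inE permK; apply/eqP; rewrite (pT i iI (T i)) (qS i iI (T i)).
Qed.

(** Converse of the preceding lemma. A matching survives any map applied to both families, so
    together the two lemmas pass from corrupted pairs to corrupted covariates. *)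
Lemma matching_corrupted (K : choiceType) (S T : 'I_n -> K) (eps : R)
    (s : 'I_n -> 'I_n) : injective s ->
  (1 - eps) * n%:R <= #|[set i | T i == S (s i)]%SET|%:R ->
  corrupted eps S T.
Proof.
move=> s_inj; set E := [set i | _]%SET => h; apply: le_trans h _.
rewrite ler_nat; pose m := [seq T i | i <- enum E].
have <- : size m = #|E| by rewrite size_map cardE.
have enumE : enum E = [seq i <- enum 'I_n | i \in E] by rewrite enumT.
have cT x : (count_mem x m <= count_mem x (codom T))%N.
  by apply: leq_count_subseq; rewrite codomE map_subseq // enumE filter_subseq.
have cS x : (count_mem x m <= count_mem x (codom S))%N.
  have -> : m = [seq S (s i) | i <- enum E].
    by apply/eq_in_map => i; rewrite mem_enum inE => /eqP.
  have /seq.permP <- : perm_eq [seq S (s i) | i <- enum 'I_n] (codom S).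
    rewrite codomE (map_comp S s) perm_map //.
    have eu := fintype.enum_uniq 'I_n.
    apply: uniq_perm => [||j] //; first by rewrite map_inj_uniq.
    rewrite mem_enum [RHS]inE; apply/mapP.
    by exists (invF s_inj j); rewrite ?mem_enum ?f_invF.
  by apply: leq_count_subseq; rewrite map_subseq // enumE filter_subseq.
have /count_subseqP[t tI /perm_size ->] : forall x,
    (count_mem x m <= count_mem x (seq_mset (codom T) `&` seq_mset (codom S))%mset)%N.
  by move=> x; rewrite count_mem_mset msetE2 !mset_seqE leq_min cT cS.
exact: size_subseq.
Qed.

End Matching.

(** * Least absolute deviations on corrupted data *)

(** Cauchy-Schwarz in a form free of square roots, by the termwise inequality a <= t a^2 / 2 + 1 /
    (2 t). The parameter [t] is balanced at each use. *)
Lemma sum_abs_le_sq (R : realType) (I : finType) (D : {set I}) (f : I -> R)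
    (t : R) : 0 < t ->
  \sum_(i in D) `|f i| <= t / 2 * \sum_(i in D) f i ^+ 2 + #|D|%:R / (2 * t).
Proof.
move=> t0; rewrite -sum1_card natr_sum mulr_sumr mulr_suml -big_split /=.
apply: ler_sum => i _; rewrite -[f i ^+ 2]real_normK ?num_real //.
set a := `|f i|; rewrite -subr_ge0.
have -> : t / 2 * a ^+ 2 + 1 / (2 * t) - a = (t * a - 1) ^+ 2 / (2 * t).
  by field; rewrite gt_eqF.
by rewrite divr_ge0 ?sqr_ge0 // mulr_ge0 // ltW.
Qed.

Section DeterministicLAD.
Variables (R : realType) (p n : nat).
Variables (x : 'I_n -> 'cV[R]_p) (z : 'I_n -> R) (betastar : 'cV[R]_p).
Variables (T : 'I_n -> 'cV[R]_p * R) (s : 'I_n -> 'I_n) (A : {set 'I_n}).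
Variables (gamma e1 L cb rho m : R).

Let S j := (x j, dot (x j) betastar + z j).

(** Write the error as H u with |u| = 1. The good indices G are the retained, matched ones with
    small noise, and B is the rest of [A]. The sum of |x_i . u| is bounded below on G and above on
    B, and comparing the losses bounds H. *)
Lemma lad_error_le (beta : 'cV[R]_p) :
  (0 < n)%N -> 0 < cb -> 0 < L -> 0 <= m ->
  e1 <= cb / 4 -> 2 * gamma <= cb / 4 ->
  2 * gamma * L <= (cb / 32) ^+ 2 -> rho ^+ 2 * L <= (cb / 32) ^+ 2 ->
  injective s ->
  (1 - gamma) * n%:R <= #|[set i | T i == S (s i)]%SET|%:R ->
  (1 - e1) * n%:R <= #|A|%:R ->
  (forall v, \sum_(i in A) dot (T i).1 v ^+ 2 <= L * n%:R * dot v v) ->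
  \sum_j (m < `|z j|)%R%:R <= gamma * n%:R ->
  (forall u, norm2 u = 1 -> exists v, norm2 (u - v) <= rho /\
     cb * n%:R <= \sum_j (4^-1 <= `|dot (x j) v|)%R%:R) ->
  lad_argmin T A beta ->
  norm2 (beta - betastar) <= 32 * m / cb.
Proof.
move=> n0 cb0 L0 m0 e1cb gcb gL rL s_inj cardE cardA AL zm net argmin.
have [h0|h0] := eqVneq (beta - betastar) 0.
  by rewrite h0 -[0](scale0r 0) norm2Z normr0 mul0r divr_ge0 ?mulr_ge0 // ltW.
have nR : 0 < n%:R :> R by rewrite ltr0n.
set h := beta - betastar in h0 *; set H := norm2 h.
have H0 : 0 < H by rewrite norm2_gt0.
pose u := H^-1 *: h.
have u1 : norm2 u = 1 by rewrite norm2Z ger0_norm ?invr_ge0 ?ltW // mulVf // gt_eqF.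
have hE : h = H *: u by rewrite scalerA mulfV ?scale1r // gt_eqF.
have [v [uv cv]] := net u u1.
set E := [set i | _]%SET in cardE.
pose Z := [set i | `|z (s i)| <= m]%SET.
pose G := (A :&: E :&: Z)%SET; pose B := (A :\: G)%SET.
have GA : G \subset A by rewrite /G -finset.setIA finset.subsetIl.
have SG i : i \in G -> T i = S (s i).
  by rewrite !inE => /andP[/andP[_ /eqP]].
have splitA (F : 'I_n -> R) :
    \sum_(i in A) F i = \sum_(i in G) F i + \sum_(i in B) F i.
  rewrite (bigID (mem G)) /=; congr (_ + _); apply: eq_bigl => i.
    by rewrite andbC andb_idr // => /(fintype.subsetP GA).
  by rewrite !inE andbC.
have cardZ : #|~: Z|%:R <= gamma * n%:R.
  apply: le_trans zm; rewrite (reindex_inj s_inj) /= -sum1_card natr_sum.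
  rewrite big_mkcond /=; apply: ler_sum => i _; rewrite !inE ltNge.
  by case: (_ <= m).
have cardB : #|B|%:R <= 2 * gamma * n%:R.
  have : (#|B| <= #|~: E| + #|~: Z|)%N.
    apply: leq_trans (leq_card_setU _ _); apply/subset_leq_card/fintype.subsetP => i.
    by rewrite !inE; case: (i \in A); rewrite //= andbT negb_and.
  rewrite -(ler_nat R) natrD; have := cardsC E; rewrite card_ord.
  move=> /(congr1 (fun k : nat => k%:R : R)); rewrite natrD; lra.
(* An index outside G is either removed by the filter, at most cb / 4 of them per sample, or lies in
   B, at most 2 gamma <= cb / 4 per sample. *)
have cardG : #|~: G|%:R <= cb / 2 * n%:R.
  have : (#|~: G| <= #|~: A| + #|B|)%N.
    apply: leq_trans (leq_card_setU _ _); apply/subset_leq_card/fintype.subsetP => i.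
    by rewrite !inE => /[dup] -> _; case: (i \in A).
  rewrite -(ler_nat R) natrD; have := cardsC A; rewrite card_ord.
  move=> /(congr1 (fun k : nat => k%:R : R)); rewrite natrD; nra.
pose f i := dot (T i).1 u; pose r i := (T i).2 - dot (T i).1 betastar.
have lossE i : (T i).2 - dot (T i).1 beta = r i - H * f i.
  have -> : beta = betastar + h by rewrite /h addrC subrK.
  by rewrite dotDr hE dotZr /r /f; ring.
have loss : \sum_(i in A) `|r i - H * f i| <= \sum_(i in A) `|r i|.
  have := argmin betastar; rewrite /lad_loss.
  by under eq_bigr do rewrite lossE.
have sumr : \sum_(i in G) `|r i| <= m * n%:R.
  have -> : n%:R = \sum_(i < n) 1 :> R by rewrite sumr_const card_ord.
  rewrite mulr_sumr big_mkcond /=; apply: ler_sum => i _.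
  case: ifP => iG; last by rewrite mulr1.
  rewrite /r (SG i iG) /= addrAC subrr add0r mulr1.
  by move: iG; rewrite !inE => /andP[].
(* The residuals on B are arbitrary, but they cancel: by the triangle inequality, moving from
   [betastar] to [beta] lowers the loss on B by at most H times the sum of |f|, whereas on G it
   raises the loss by at least H times the sum of |f| minus twice the noise. *)
have key : H * \sum_(i in G) `|f i| <=
    2 * (m * n%:R) + H * \sum_(i in B) `|f i|.
  have Gf : H * \sum_(i in G) `|f i| <=
      \sum_(i in G) `|r i - H * f i| + \sum_(i in G) `|r i|.
    rewrite mulr_sumr -big_split /=; apply: ler_sum => i _.
    rewrite -{1}(gtr0_norm H0) -normrM.
    have := ler_normB (r i) (r i - H * f i).
    have -> : r i - (r i - H * f i) = H * f i by ring.
    by rewrite addrC.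
  have Bf : \sum_(i in B) `|r i| <=
      \sum_(i in B) `|r i - H * f i| + H * \sum_(i in B) `|f i|.
    rewrite mulr_sumr -big_split /=; apply: ler_sum => i _.
    rewrite -{2}(gtr0_norm H0) -normrM.
    have := ler_normD (r i - H * f i) (H * f i).
    by rewrite subrK.
  by move: loss; rewrite !splitA; lra.
have sqB : \sum_(i in B) f i ^+ 2 <= L * n%:R.
  have := AL u; rewrite -sqr_norm2 u1 expr1n mulr1; apply: le_trans.
  rewrite splitA lerDr; apply: sumr_ge0 => i _; exact: sqr_ge0.
have fB : \sum_(i in B) `|f i| <= cb / 32 * n%:R.
  (* This value of [t] makes each of the two terms at most cb n / 64. *)
  have t0 : 0 < cb / (32 * L) by rewrite divr_gt0 // mulr_gt0.
  apply: le_trans (sum_abs_le_sq B f t0) _.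
  have -> : cb / 32 * n%:R =
      cb / (32 * L) / 2 * (L * n%:R) + cb / 64 * n%:R.
    by field; rewrite gt_eqF.
  apply: lerD; first by rewrite ler_wpM2l // ltW // divr_gt0.
  have t2 : 0 < 2 * (cb / (32 * L)) by rewrite mulr_gt0.
  rewrite (ler_pdivrMr _ _ t2) -(ler_pM2r L0).
  have -> : cb / 64 * n%:R * (2 * (cb / (32 * L))) * L = (cb / 32) ^+ 2 * n%:R.
    by field; rewrite gt_eqF.
  apply: le_trans (_ : 2 * gamma * n%:R * L <= _); first by rewrite ler_pM2r.
  by rewrite mulrAC ler_pM2r.
(* At least cb n indices have margin 1/4 in the direction v, and at most cb n / 2 of them lie
   outside G; the rest contribute cb n / 8. Replacing v by u costs cb n / 32. *)
have fG : (cb / 8 - cb / 32) * n%:R <= \sum_(i in G) `|f i|.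
  pose g i := dot (T i).1 (u - v).
  have gG : \sum_(i in G) `|g i| <= cb / 32 * n%:R.
    have t0 : 0 < 32 / cb by rewrite divr_gt0.
    apply: le_trans (sum_abs_le_sq G g t0) _.
    have gq : \sum_(i in G) g i ^+ 2 <= (cb / 32) ^+ 2 * n%:R.
      apply: (@le_trans _ _ (L * n%:R * dot (u - v) (u - v))).
        apply: le_trans (AL (u - v)); rewrite splitA lerDl.
        by apply: sumr_ge0 => i _; exact: sqr_ge0.
      rewrite -sqr_norm2 mulrAC ler_pM2r //; apply: le_trans rL.
      have rho0 := le_trans (norm2_ge0 _) uv.
      by rewrite mulrC ler_pM2r // ler_pXn2r ?nnegrE ?norm2_ge0.
    have cG : #|G|%:R <= n%:R :> R by rewrite ler_nat -[X in (_ <= X)%N](card_ord n) max_card.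
    have -> : cb / 32 * n%:R = 32 / cb / 2 * ((cb / 32) ^+ 2 * n%:R) + n%:R / (2 * (32 / cb)).
      by field; rewrite gt_eqF.
    apply: lerD; first by rewrite ler_wpM2l // ltW // divr_gt0.
    by rewrite ler_wpM2r // invr_ge0 mulr_ge0 // ltW.
  have : \sum_(i in G) 4^-1 * (4^-1 <= `|dot (x (s i)) v|)%R%:R <=
      \sum_(i in G) `|f i| + \sum_(i in G) `|g i|.
    rewrite -big_split /=; apply: ler_sum => i iG.
    have -> : dot (x (s i)) v = f i - g i.
      by rewrite /f /g dotBr opprB addrC subrK (SG i iG).
    have := ler_normB (f i) (g i).
    case: (leP 4^-1 _) => h4; rewrite ?mulr1 ?mulr0 => h5; first exact: le_trans h5.
    by rewrite addr_ge0.
  rewrite -mulr_sumr.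
  have : cb * n%:R <= \sum_(i in G) (4^-1 <= `|dot (x (s i)) v|)%R%:R + #|~: G|%:R.
    apply: le_trans cv _; rewrite (reindex_inj s_inj) /=.
    rewrite (bigID (mem G)) /= lerD2l -sum1_card natr_sum.
    rewrite [leRHS](eq_bigl (fun i => i \notin G)) => [|i]; last first.
      by rewrite finset.in_setC.
    by apply: ler_sum => i _; rewrite ler_nat; case: (4^-1 <= _).
  by lra.
rewrite ler_pdivlMr //.
(* After subtracting the contribution of B, the coefficient of H is cb / 8 - cb / 32 - cb / 32 = cb
   / 16, against 2 m. *)
have : H * ((cb / 8 - cb / 32) * n%:R) <= 2 * (m * n%:R) + H * (cb / 32 * n%:R).
  apply: le_trans (_ : H * \sum_(i in G) `|f i| <= _); first by rewrite ler_pM2l.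
  by apply: le_trans key _; rewrite lerD2l ler_pM2l.
move=> le1; have : H * cb * n%:R <= 32 * m * n%:R by lra.
by rewrite ler_pM2r.
Qed.

End DeterministicLAD.

(** * Stability *)

Section Stability.
Variables (R : realType) (p n : nat).
Implicit Types (x : 'I_n -> 'cV[R]_p) (A B : {set 'I_n}) (M : 'M[R]_p).

Lemma dot_second_moment x A u v :
  dot u (second_moment x 0 A *m v) =
  #|A|%:R^-1 * \sum_(i in A) (dot (x i) u * dot (x i) v).
Proof.
rewrite /second_moment -scalemxAl dotZr mulmx_suml dot_sumr; congr (_ * _).
by apply: eq_bigr => i _; rewrite subr0 dot_outer.
Qed.

Lemma norm2_mulmx_le_opnorm M v : norm2 v <= 1 -> norm2 (M *m v) <= opnorm M.
Proof.
move=> v1; apply: ub_le_sup; last by exists v.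
(* The set must be bounded for its supremum to be an upper bound; the Frobenius norm, summed over
   the rows of [M], bounds it. *)
exists (Num.sqrt (\sum_k dot (\col_j M k j) (\col_j M k j))) => _ [u /= u1 <-].
rewrite norm2E ler_sqrt ?sumr_ge0 // => [|k _]; last exact: dotvv_ge0.
apply: ler_sum => k _.
have -> : (M *m u) k 0 = dot (\col_j M k j) u.
  by rewrite mxE; apply: eq_bigr => j _; rewrite mxE.
rewrite -expr2; apply: le_trans (dot_cauchy_schwarz _ _) _.
rewrite ler_piMr ?dotvv_ge0 // -sqr_norm2.
by rewrite expr_le1 ?norm2_ge0.
Qed.

(** Stability is applied to the whole of [A]: the second moment matrix differs from the identity by
    at most delta^2 / eps in operator norm, and |A| <= n. *)
Lemma stable_second_moment_le x A eps delta : (0 < n)%N ->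
  stable x A eps delta 0 1 ->
  forall v, \sum_(i in A) dot (x i) v ^+ 2
    <= (1 + delta ^+ 2 / eps) * n%:R * dot v v.
Proof.
move=> n0 [[/andP[eps0 eps2] eps_delta] stabA] v.
have [|_ opA] := stabA A (subxx _).
  by rewrite ler_piMl //; lra.
have [->|v0] := eqVneq v 0.
  by rewrite !dot0r mulr0 big1 // => i _; rewrite dot0r expr0n.
set b := 1 + _; have b0 : 0 <= b by rewrite addr_ge0 // divr_ge0 ?sqr_ge0 // ltW.
have [A0|A0] := posnP #|A|.
  rewrite (cards0_eq A0) big_set0 !mulr_ge0 //; exact: dotvv_ge0.
have N0 : 0 < norm2 v by rewrite norm2_gt0.
pose u := (norm2 v)^-1 *: v.
have u1 : norm2 u = 1 by rewrite norm2Z ger0_norm ?invr_ge0 ?ltW // mulVf // gt_eqF.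
have vE : v = norm2 v *: u by rewrite scalerA mulfV ?scale1r // gt_eqF.
have Muu : dot u (second_moment x 0 A *m u) <= b.
  have := opA; rewrite expr1n mul1r => {}opA.
  have Nu : norm2 ((second_moment x 0 A - 1%:M) *m u) <= delta ^+ 2 / eps.
    by apply: le_trans opA; apply: norm2_mulmx_le_opnorm; rewrite u1.
  have := le_trans (ler_norm _) (dot_le_norm2 u ((second_moment x 0 A - 1%:M) *m u)).
  rewrite mulmxBl mul1mx in Nu *.
  by rewrite u1 mul1r dotBr -sqr_norm2 u1 expr1n /b; lra.
have aR : 0 < #|A|%:R :> R by rewrite ltr0n.
rewrite dot_second_moment ler_pdivrMl // in Muu.
have -> : \sum_(i in A) dot (x i) v ^+ 2 =
    norm2 v ^+ 2 * \sum_(i in A) dot (x i) u * dot (x i) u.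
  rewrite mulr_sumr; apply: eq_bigr => i _.
  by rewrite {1}vE dotZr exprMn -[in RHS]expr2.
rewrite -sqr_norm2 mulrC ler_wpM2r ?sqr_ge0 //; apply: le_trans Muu _.
rewrite mulrC ler_wpM2l // ler_nat -[leqRHS](card_ord n).
exact: max_card.
Qed.

Lemma dot_mean x A u : dot u (mean x A) = #|A|%:R^-1 * \sum_(i in A) dot (x i) u.
Proof.
rewrite /mean dotZr dot_sumr; congr (_ * _).
by apply: eq_bigr => i _; rewrite dotC.
Qed.

(** For large [delta] an upper bound on second moments is enough. A large subset B has at least n /
    4 points, so its second moment form is at most 4 Lam, and this controls both the mean and the
    operator norm. *)
Lemma stable_of_second_moment_le x A (Lam eps delta : R) : (0 < n)%N -> 0 < Lam ->
  stability_range eps delta -> 4 * Lam + 1 <= delta -> n%:R / 2 <= #|A|%:R :> R ->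
  (forall v, \sum_(i in A) dot (x i) v ^+ 2 <= Lam * n%:R * dot v v) ->
  stable x A eps delta 0 1.
Proof.
move=> n0 L0 rg Ldelta cardA ALam; split=> // B BA cardB.
have [/andP[eps0 eps2] eps_delta] := rg.
have nR : 0 < n%:R :> R by rewrite ltr0n.
have cB : n%:R / 4 <= #|B|%:R :> R by apply: le_trans cardB; nra.
have bR : 0 < #|B|%:R :> R by apply: lt_le_trans cB; rewrite divr_gt0.
have Bq v : #|B|%:R^-1 * \sum_(i in B) dot (x i) v ^+ 2 <= 4 * Lam * dot v v.
  rewrite ler_pdivrMl //; apply: (@le_trans _ _ (Lam * n%:R * dot v v)).
    apply: le_trans (ALam v); rewrite [leRHS](bigID (mem B)) /=.
    rewrite [X in _ <= X + _](eq_bigl (mem B)) => [|i]; last first.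
      by rewrite andbC andb_idr // => /(fintype.subsetP BA).
    by rewrite lerDl sumr_ge0 // => i _; exact: sqr_ge0.
  have := dotvv_ge0 v; set D := dot v v => D0.
  have : Lam * D * (n%:R / 4) <= Lam * D * #|B|%:R.
    by rewrite ler_wpM2l // mulr_ge0 // ltW.
  by lra.
have delta0 : 0 <= delta by lra.
have delta1 : 1 <= delta by lra.
rewrite expr1n !mul1r subr0; split.
  rewrite -(@ler_pXn2r _ 2) ?nnegrE ?norm2_ge0 // sqr_norm2.
  apply: (@le_trans _ _ (4 * Lam)); last by nra.
  set m := mean x B; have mE : dot m m = _ := dot_mean x B m.
  (* With this [t] the quadratic term is at most half of |m|^2, and the inequality closes to |m|^2
     <= 4 Lam. *)
  have t0 : 0 < (4 * Lam)^-1 by rewrite invr_gt0 mulr_gt0.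
  have := sum_abs_le_sq B (fun i => dot (x i) m) t0.
  have bi : 0 < #|B|%:R^-1 :> R by rewrite invr_gt0.
  move=> h2.
  have : \sum_(i in B) dot (x i) m <= \sum_(i in B) `|dot (x i) m|.
    by apply: ler_sum => i _; exact: ler_norm.
  move=> /le_trans /(_ h2).
  rewrite -(ler_pM2l bi) -mE mulrDr mulrCA.
  have -> : #|B|%:R^-1 * (#|B|%:R / (2 * (4 * Lam)^-1)) = 2 * Lam.
    by field; rewrite !gt_eqF.
  move=> h4; have h3 := ler_wpM2l (ltW t0) (Bq m).
  have h5 : (4 * Lam)^-1 * (4 * Lam * dot m m) = dot m m.
    by field; rewrite gt_eqF.
  by rewrite h5 in h3; lra.
apply: (@le_trans _ _ (4 * Lam + 1)); last first.
  rewrite ler_pdivlMr //; apply: le_trans (_ : delta <= _); first by nra.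
  by nra.
apply: ge_sup; first by exists (norm2 ((second_moment x 0 B - 1%:M) *m 0)), 0 => //=;
  rewrite -[0](scale0r 0) norm2Z normr0 mul0r.
move=> _ [v /= v1 <-]; rewrite mulmxBl mul1mx.
apply: le_trans (norm2_triangle _ _) _; rewrite norm2N; apply: lerD => //.
set M := second_moment x 0 B.
have sM : M^T = M.
  rewrite /M /second_moment linearZ /= linear_sum /=; congr (_ *: _).
  by apply: eq_bigr => i _; rewrite trmx_mul trmxK.
have Mq w : dot w (M *m w) <= 4 * Lam * dot w w.
  by rewrite dot_second_moment; under eq_bigr do rewrite -expr2; exact: Bq.
have M0 w : 0 <= dot w (M *m w).
  rewrite dot_second_moment mulr_ge0 ?invr_ge0 ?ler0n //.
  by apply: sumr_ge0 => i _; rewrite -expr2 sqr_ge0.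
(* For w = M v this reads |w|^4 <= (w^T M w)(v^T M v) <= (4 Lam |w|^2)(4 Lam), so that |M v| <= 4
   Lam. *)
have cs := form_cauchy_schwarz (M *m v) v sM M0.
have [->|w0] := eqVneq (M *m v) 0.
  by rewrite -[0](scale0r 0) norm2Z normr0 mul0r mulr_ge0 // ltW.
have D0 := dotvv_gt0 w0; set w := M *m v in cs w0 D0 *.
have vv1 : dot v v <= 1 by rewrite -sqr_norm2 expr_le1 ?norm2_ge0.
have : dot w w ^+ 2 <= 4 * Lam * dot w w * (4 * Lam).
  apply: le_trans cs _; apply: ler_pM => //.
  by apply: le_trans (Mq v) _; rewrite ler_piMr // mulr_ge0 // ltW.
have -> : 4 * Lam * dot w w * (4 * Lam) = dot w w * (4 * Lam) ^+ 2 by ring.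
rewrite expr2 ler_pM2l // => h.
rewrite -(@ler_pXn2r _ 2) ?nnegrE ?norm2_ge0 ?sqr_norm2 //.
by rewrite mulr_ge0 // ltW.
Qed.

End Stability.

(** * Nets and cells *)

Section GridNet.
Variables (R : realType) (p m0 : nat).

Definition grid_point (k : {ffun 'I_p -> 'I_(2 * (p * m0)).+1}) : 'cV[R]_p :=
  \col_j ((k j)%:R / (p * m0)%:R - 1).

(** Rounding down each coordinate of u costs at most 1 / (p m0), hence at most 1 / (p m0^2) in
    squared norm. The grid has (2 p m0 + 1)^p points, which is where p log p comes from. *)
Lemma grid_net (u : 'cV[R]_p) : (0 < p)%N -> (0 < m0)%N -> norm2 u = 1 ->
  exists k, norm2 (u - grid_point k) <= m0%:R^-1.
Proof.
move=> p0 m00 u1; set N : nat := (p * m0)%N.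
have N0 : 0 < N%:R :> R by rewrite ltr0n muln_gt0 p0.
have uj j : -1 <= u j 0 <= 1.
  rewrite -ler_norml -dot_delta; apply: le_trans (dot_le_norm2 _ _) _.
  by rewrite norm2_delta u1 mulr1.
have uN0 j : 0 <= (u j 0 + 1) * N%:R.
  by have /andP[h _] := uj j; rewrite mulr_ge0 // ?ler0n //; lra.
pose k : {ffun 'I_p -> 'I_(2 * (p * m0)).+1} :=
  [ffun j => inord (Num.truncn ((u j 0 + 1) * N%:R))].
have kE j : (k j : nat) = Num.truncn ((u j 0 + 1) * N%:R).
  rewrite ffunE inordK // ltnS -/N -(ler_nat R).
  have /andP[h _] := truncn_itv (uN0 j); apply: le_trans h _.
  have /andP[_ h] := uj j; rewrite natrM ler_pM2r //; lra.
exists k; rewrite -(@ler_pXn2r _ 2) ?nnegrE ?norm2_ge0 ?invr_ge0 ?ler0n //.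
rewrite sqr_norm2 /dot.
apply: (@le_trans _ _ (\sum_(j < p) (N%:R^-1) ^+ 2)).
  apply: ler_sum => j _; rewrite !mxE kE -/N -expr2.
  have /andP[h1 h2] := truncn_itv (uN0 j).
  set t := (Num.truncn _)%:R in h1 h2 *.
  have -> : u j 0 - (t / N%:R - 1) = ((u j 0 + 1) * N%:R - t) / N%:R.
    by field; rewrite gt_eqF.
  rewrite exprMn ler_piMl ?sqr_ge0 // expr_le1 //; last by rewrite subr_ge0.
  by move: h2; rewrite -natr1 -/t; lra.
have -> : \sum_(j < p) (N%:R^-1) ^+ 2 = p%:R^-1 * (m0%:R^-1) ^+ 2 :> R.
  rewrite sumr_const card_ord -[LHS]mulr_natr /N natrM; field.
  by rewrite !gt_eqF ?ltr0n.
rewrite ler_piMl ?sqr_ge0 //.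
by rewrite invf_le1 ?ltr0n // ler1n.
Qed.

End GridNet.

Section Cells.
Variables (R : realType) (p m : nat) (rad eta : R).

Definition bucket (t : R) : option 'I_m.+1 :=
  if -rad <= t <= rad then Some (inord (Num.truncn ((t + rad) / eta))) else None.

(** Discretizing the covariate makes the alphabet finite, so that conditioning on past draws becomes
    a finite sum. [None] marks a coordinate outside [-rad, rad]. *)
Definition cell (e : p.-tuple R * R) : {ffun 'I_p -> option 'I_m.+1} :=
  [ffun k => bucket (tnth e.1 k)].

Definition in_box (a : {ffun 'I_p -> option 'I_m.+1}) : bool :=
  [forall k, a k != None].

Definition cell_point (a : {ffun 'I_p -> option 'I_m.+1}) : 'cV[R]_p :=
  \col_k (if a k is Some i then i%:R * eta - rad else 0).

Hypothesis eta_gt0 : 0 < eta.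
Hypothesis rad_m : 2 * rad / eta < m.+1%:R.

Lemma bucket_trunc t : -rad <= t <= rad ->
  [/\ 0 <= (t + rad) / eta & (Num.truncn ((t + rad) / eta) < m.+1)%N].
Proof.
move=> /andP[h1 h2]; have t0 : 0 <= (t + rad) / eta.
  by apply: divr_ge0; [lra|exact: ltW].
split=> //; rewrite -(ltr_nat R); apply: le_lt_trans rad_m.
have /andP[h _] := truncn_itv t0; apply: le_trans h _.
by rewrite ler_pM2r ?invr_gt0 //; lra.
Qed.

Lemma cell_point_close (e : p.-tuple R * R) k : in_box (cell e) ->
  `|cell_point (cell e) k 0 - tnth e.1 k| <= eta.
Proof.
move=> /forallP /(_ k); rewrite mxE ffunE /bucket.
case: ifP => // rt _; have [t0 tm] := bucket_trunc rt.
rewrite inordK //; have /andP[h1 h2] := truncn_itv t0.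
set s := (Num.truncn _)%:R in h1 h2 *; set t := tnth _ _ in h1 h2 *.
move: h1 h2; rewrite -natr1 -/s ler_pdivlMr // ltr_pdivrMr // => h1 h2.
by rewrite ler_norml; apply/andP; split; lra.
Qed.

Lemma in_boxPn (e : p.-tuple R * R) : ~~ in_box (cell e) ->
  exists k, rad < `|tnth e.1 k|.
Proof.
rewrite negb_forall => /existsP[k]; rewrite negbK ffunE /bucket => /eqP.
case: ifP => // h _; exists k; rewrite ltNge; apply/negP.
by rewrite ler_norml h.
Qed.

Lemma measurable_bucket o : measurable (bucket @^-1` [set o]).
Proof.
case: o => [i|].
  have -> : bucket @^-1` [set Some i] =
      `[-rad, rad] `&` `[i%:R * eta - rad, i.+1%:R * eta - rad[.
    apply/seteqP; split=> t; rewrite /bucket /= !in_itv /=.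
      case: ifP => // rt [] ti; have [t0 tm] := bucket_trunc rt.
      split=> //; have : Num.truncn ((t + rad) / eta) == i.
        by rewrite -ti inordK.
      by rewrite truncn_eq // ler_pdivlMr // ltr_pdivrMr // ltrBrDr lerBlDr.
    case=> rt h; rewrite rt; congr Some; have [t0 tm] := bucket_trunc rt.
    apply: val_inj; rewrite /= inordK //; apply/eqP.
    by rewrite truncn_eq // ler_pdivlMr // ltr_pdivrMr // -ltrBrDr -lerBlDr.
  by apply: measurableI; exact: measurable_itv.
have -> : bucket @^-1` [set None] = ~` `[-rad, rad].
  apply/seteqP; split=> t; rewrite /bucket /= in_itv /=; case: ifP => //.
by apply: measurableC; exact: measurable_itv.
Qed.

Lemma measurable_cell a : measurable (cell @^-1` [set a]).
Proof.
have -> : cell @^-1` [set a] =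
    \bigcap_k ((fun e : p.-tuple R * R => tnth e.1 k) @^-1`
                 (bucket @^-1` [set a k])).
  apply/seteqP; split=> e /=; first by move=> <- k _ /=; rewrite ffunE.
  by move=> h; apply/ffunP => k; rewrite ffunE; apply: h.
apply: fin_bigcap_measurable => // k _.
rewrite -[X in measurable X]setTI.
have : measurable_fun setT (fun e : p.-tuple R * R => tnth e.1 k).
  apply: (@measurableT_comp _ _ _ _ _ _ (fun t : p.-tuple R => tnth t k)) => //=.
  exact: measurable_tnth.
by apply => //; exact: measurable_bucket.
Qed.

End Cells.

(** * Bounded second moments after deleting few points *)

(** Split e into its coordinate components. By positivity each cross term is at most the mean of the
    two diagonal terms, so the form is at most p times the sum of the diagonal terms. *)
Lemma posdef_form_le_trace (R : realType) (p : nat) (M : 'M[R]_p)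
    (e : 'cV[R]_p) (eta : R) : posdef M -> (forall k, `|e k 0| <= eta) ->
  dot e (M *m e) <= p%:R * eta ^+ 2 * \tr M.
Proof.
move=> pM ee; pose w k : 'cV[R]_p := e k 0 *: delta_mx k 0.
have -> : e = \sum_k w k.
  apply/matrixP => k j; rewrite ord1 summxE (bigD1 k) //= big1 => [|l /negPf lk].
    by rewrite !mxE !eqxx mulr1 addr0.
  by rewrite !mxE eq_sym lk mulr0.
pose q k := dot (w k) (M *m w k).
apply: (@le_trans _ _ (p%:R * \sum_k q k)).
  rewrite mulmx_sumr dot_sumr.
  apply: (@le_trans _ _ (\sum_l \sum_k (q k + q l) / 2)).
    apply: ler_sum => l _; rewrite dotC dot_sumr; apply: ler_sum => k _.
    have sym : dot (w l) (M *m w k) = dot (w k) (M *m w l).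
      by rewrite dot_mulmxr pM.1 dotC.
    have := posdef_ge0 (w k - w l) pM.
    by rewrite mulmxBr dotBl !dotBr sym (dotC (M *m w l)) /q; lra.
  have -> : \sum_l \sum_k (q k + q l) / 2 = p%:R * \sum_k q k.
    transitivity (\sum_l ((\sum_k q k) + p%:R * q l) / 2).
      apply: eq_bigr => l _.
      by rewrite -mulr_suml big_split /= sumr_const card_ord mulr_natl.
    rewrite -mulr_suml big_split /= sumr_const card_ord -mulr_sumr.
    by rewrite -[X in X + _]mulr_natl; field.
  by [].
rewrite -mulrA ler_wpM2l // trace_dot mulr_sumr; apply: ler_sum => k _.
rewrite /q /w -scalemxAr dotZl dotZr mulrA -expr2.
rewrite ler_wpM2r ?posdef_ge0 // -[e k 0 ^+ 2]real_normK ?num_real //.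
by rewrite ler_pXn2r ?nnegrE //; apply: le_trans (ee k).
Qed.

Section CovariateBound.
Context {R : realType} {d : measure_display} {Omega : measurableType d}.
Variables (P : probability Omega R) (p n : nat).
Variables (x : 'I_n -> Omega -> 'cV[R]_p) (z : 'I_n -> Omega -> R).
Hypothesis iid : iid_pairs P x z.

Lemma measurable_coord i k : measurable_fun setT (fun w => x i w k 0).
Proof.
have [mobs _ _] := iid.
have -> : (fun w => x i w k 0) =
    (fun e : p.-tuple R * R => tnth e.1 k) \o pair_obs (x i) (z i).
  by apply/funext => w /=; rewrite tnth_mktuple.
apply: measurableT_comp => //.
apply: (@measurableT_comp _ _ _ _ _ _ (fun t : p.-tuple R => tnth t k)) => //=.
exact: measurable_tnth.
Qed.

Lemma measurable_noise i : measurable_fun setT (z i).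
Proof.
have [mobs _ _] := iid.
have -> : z i = snd \o pair_obs (x i) (z i) by [].
exact: measurableT_comp.
Qed.

Hypothesis p_gt0 : (0 < p)%N.
Hypothesis p_le_n : (p <= n)%N.
Variable i0 : 'I_n.
Hypothesis x_iso : second_moment_id P (x i0).

(* With cells of side 1/p the discretization error contributes at most tr M
   to the quadratic form of M. *)
Lemma cell_law_bounds (beta : R) : 0 < beta ->
  exists (m : nat) (rad : R),
    [/\ 2 * rad / p%:R^-1 < m.+1%:R,
     \sum_(a | ~~ in_box a)
        law P (fun i => pair_obs (x i) (z i)) (cell m rad p%:R^-1) i0 a <= beta &
     forall M : 'M[R]_p, posdef M ->
       \sum_(a | in_box a)
          law P (fun i => pair_obs (x i) (z i)) (cell m rad p%:R^-1) i0 a *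
            dot (cell_point rad p%:R^-1 a) (M *m cell_point rad p%:R^-1 a)
        <= 4 * \tr M].
Proof.
move=> beta0; have pR : 0 < p%:R :> R by rewrite ltr0n.
(* Chosen so that p / rad^2 <= beta, since p = beta (rad - 1). *)
pose rad : R := 1 + p%:R / beta; pose m := Num.truncn (2 * rad / p%:R^-1).
have rad1 : 1 <= rad by rewrite lerDl divr_ge0 // ltW.
have eta0 : 0 < p%:R^-1 :> R by rewrite invr_gt0.
have radm : 2 * rad / p%:R^-1 < m.+1%:R.
  have r0 : 0 <= 2 * rad / p%:R^-1.
    by rewrite invrK mulr_ge0 ?ltW // mulr_gt0 // (lt_le_trans ltr01).
  by have /andP[] := truncn_itv r0.
exists m, rad; have [mobs _ _] := iid.
have mcell (a : {ffun 'I_p -> option 'I_m.+1}) : measurable (cell m rad p%:R^-1 @^-1` [set a]).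
  exact: measurable_cell.
set c := cell m rad p%:R^-1 in mcell *.
set obs := fun i : 'I_n => pair_obs (x i) (z i); set cp := cell_point rad p%:R^-1.
have lawE F := @law_expect R _ _ _ _ P n obs mobs _ c mcell i0 F.
have obsE w k : tnth (obs i0 w).1 k = x i0 w k 0 by rewrite tnth_mktuple.
have mx := measurable_coord i0.
have mquad M : measurable_fun setT (fun w => dot (x i0 w) (M *m x i0 w)).
  apply: measurable_sum => k; apply: measurable_funM => //.
  under eq_fun do rewrite mxE.
  by apply: measurable_sum => l; apply: measurable_funM.
have mF (F : {ffun 'I_p -> option 'I_m.+1} -> R) :
    measurable_fun setT (fun w => F (c (obs i0 w))).
  have -> : (fun w => F (c (obs i0 w))) =
      (fun w => \sum_a F a * \1_(obs i0 @^-1` (c @^-1` [set a])) w).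
    apply/funext => w; rewrite (bigD1 (c (obs i0 w))) //= big1 => [|a /negPf ag].
      by rewrite indicE mem_set //= mulr1 addr0.
    by rewrite indicE memNset ?mulr0 //= => /eqP; rewrite eq_sym ag.
  apply: measurable_sum => a; apply: measurable_funM => //.
  by apply: measurable_indic; exact: measurable_fiber.
split=> //.
  have -> : \sum_(a | ~~ in_box a) law P obs c i0 a =
      \sum_a law P obs c i0 a * (~~ in_box a)%:R.
    rewrite big_mkcond; apply: eq_bigr => a _.
    by case: (~~ _); rewrite ?mulr1 ?mulr0.
  rewrite -lee_fin -lawE; last by move=> a; rewrite ler0n.
  (* Outside the box some coordinate exceeds [rad], so the indicator is at most |x|^2 / rad^2, of
     mean p / rad^2. *)
  apply: (@le_trans _ _ (\int[P]_w (dot (x i0 w) (((rad ^+ 2)^-1)%:M *m x i0 w))%:E)%E).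
    apply: ge0_le_integral => //.
    - by apply/measurable_EFinP; exact: (mF (fun a => (~~ in_box a)%:R)).
    - exact/measurable_EFinP.
    - move=> w _; rewrite lee_fin dot_scalar.
      case: (boolP (in_box _)) => [_|/in_boxPn[k]] /=.
        by rewrite mulr_ge0 ?dotvv_ge0 // invr_ge0 sqr_ge0.
      rewrite obsE => hk; rewrite mulrC ler_pdivlMr ?mul1r; last first.
        by rewrite exprn_gt0 // (lt_le_trans ltr01).
      rewrite /dot (bigD1 k) //= -expr2 -[leLHS]addr0 lerD //.
        rewrite -[x i0 w k 0 ^+ 2]real_normK ?num_real //.
        rewrite ler_pXn2r ?nnegrE ?(ltW hk) //.
        exact: le_trans ler01 rad1.
      by apply: sumr_ge0 => l _; rewrite -expr2 sqr_ge0.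
  rewrite (quad_expect mx x_iso) lee_fin mxtrace_scalar -[leLHS]mulr_natr.
  rewrite mulrC ler_pdivrMr ?exprn_gt0 ?(lt_le_trans ltr01) //.
  have : p%:R = beta * (rad - 1) by rewrite /rad; field; rewrite gt_eqF.
  move=> ->; rewrite ler_pM2l //; have := sqr_ge0 (rad - 1); rewrite sqrrB mulr1 -mulr_natl expr1n; move: rad1; lra.
move=> M pM.
have -> : \sum_(a | in_box a) law P obs c i0 a * dot (cp a) (M *m cp a) =
    \sum_a law P obs c i0 a * (if in_box a then dot (cp a) (M *m cp a) else 0).
  rewrite big_mkcond; apply: eq_bigr => a _.
  by case: (in_box a); rewrite ?mulr0.
rewrite -lee_fin -(lawE (fun a => if in_box a then dot (cp a) (M *m cp a) else 0)); last first.
  by move=> a; case: (in_box a) => //; exact: posdef_ge0.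
have trM := posdef_trace_ge0 pM.
(* The cell point is x + e with e^T M e <= tr M, and the form at x + e is at most twice the form at
   x plus twice the form at e. The mean is thus at most 2 tr M + 2 tr M. *)
apply: (@le_trans _ _ (\int[P]_w ((2 * \tr M)%:E +
    2%:E * (dot (x i0 w) (M *m x i0 w))%:E))%E).
  apply: ge0_le_integral => //.
  - by move=> w _; rewrite lee_fin; case: (in_box _) => //; exact: posdef_ge0.
  - by apply/measurable_EFinP; exact: (mF (fun a => if in_box a then dot (cp a) (M *m cp a) else 0)).
  - apply: emeasurable_funD => //; apply: measurable_funeM.
    exact/measurable_EFinP.
  - move=> w _; rewrite -EFinM -EFinD lee_fin.
    have x0 := posdef_ge0 (x i0 w) pM.
    case: ifP => [box|_]; last by rewrite addr_ge0 // mulr_ge0.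
    set a := c (obs i0 w) in box *.
    have [e eE] : {e | e = cp a - x i0 w} by exists (cp a - x i0 w).
    have ee k : `|e k 0| <= p%:R^-1.
      by rewrite eE !mxE -obsE; have := cell_point_close eta0 radm k box; rewrite mxE.
    have eM := posdef_form_le_trace pM ee.
    have e1 : dot e (M *m e) <= \tr M.
      apply: le_trans eM _; rewrite ler_piMl //.
      by rewrite expr2 mulrA mulfV ?mul1r ?gt_eqF // invf_le1 ?ler1n.
    have -> : cp a = x i0 w + e by rewrite eE addrC subrK.
    have := posdef_ge0 (x i0 w - e) pM.
    rewrite mulmxBr mulmxDr dotBl dotDl !dotBr !dotDr; lra.
rewrite ge0_integralD //; last 3 first.
- by move=> w _; rewrite lee_fin mulr_ge0.
- by move=> w _; rewrite -EFinM lee_fin mulr_ge0 // posdef_ge0.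
- by apply: measurable_funeM; exact/measurable_EFinP.
rewrite integral_cst // [X in (_ * X)%E](probability_setT P) mule1.
rewrite ge0_integralZl //; last 2 first.
- exact/measurable_EFinP.
- by move=> w _; rewrite lee_fin posdef_ge0.
by rewrite (quad_expect mx x_iso) -EFinM -EFinD lee_fin; lra.
Qed.

Lemma covariates_bounded_whp (eps : R) : 0 < eps < 1 ->
  exists Ev : set Omega,
    [/\ measurable Ev, (P (~` Ev) <= (expR (- (eps / 4 * n%:R)))%:E)%E &
     forall w, Ev w -> exists A : {set 'I_n},
       (1 - eps) * n%:R <= #|A|%:R /\
       forall v, \sum_(i in A) dot (x i w) v ^+ 2
         <= (512 / eps + 2) * n%:R * dot v v].
Proof.
move=> /andP[eps0 eps1]; have pR : 0 < p%:R :> R by rewrite ltr0n.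
have nR : 0 < n%:R :> R by rewrite ltr0n (leq_trans p_gt0).
have beta0 : 0 < eps / 16 by rewrite divr_gt0.
have [m [rad [radm badp good_mom]]] := cell_law_bounds beta0.
have [mobs obs_id obs_indep] := iid.
have eta0 : 0 < p%:R^-1 :> R by rewrite invr_gt0.
have mcell (a : {ffun 'I_p -> option 'I_m.+1}) :
    measurable (cell m rad p%:R^-1 @^-1` [set a]) by exact: measurable_cell.
set c := cell m rad p%:R^-1 in badp good_mom mcell *.
set obs := fun i : 'I_n => pair_obs (x i) (z i) in badp good_mom *.
set cp := cell_point rad p%:R^-1 in good_mom *.
(* With beta = eps / 16, each of the three terms of the refusal probability is eps / 16, so their
   sum is below eps / 4. The initial matrix [B0] has potential exactly [phi]. *)
pose dl : R := 128 / eps; pose phi : R := eps / 128.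
have dl0 : 0 < dl by rewrite divr_gt0.
have phi0 : 0 < phi by rewrite divr_gt0.
pose B0 : 'M[R]_p := (p%:R / phi)%:M.
have invB0 : barrier_inv phi B0.
  split; first by apply: posdef_scalar; rewrite divr_gt0.
  rewrite invmx_scalar mxtrace_scalar -[leLHS]mulr_natr invf_div mulfVK //.
  by rewrite gt_eqF.
pose Q (t : n.-tuple {ffun 'I_p -> option 'I_m.+1}) := eps * n%:R <
  total_cost (barrier_next (@in_box p m) cp dl) (refusal (@in_box p m) cp dl) B0 t.
have mQ := measurable_sample_event mobs mcell Q.
exists (~` [set w | Q (sample obs c w)]); split; first exact: measurableC.
  rewrite setCK.
  have := @adaptive_count_tail R _ _ _ _ P n obs mobs obs_id obs_indep _ c i0 _
    (barrier_next (@in_box p m) cp dl)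
    (fun B a => ~~ accept (@in_box p m) cp dl B a) (barrier_inv phi)
    (eps / 4) (eps * n%:R) B0 Q mcell.
  have -> : eps / 4 * n%:R - eps * n%:R / 2 = - (eps / 4 * n%:R) by field.
  apply => // [B a|B iB|t /ltW //]; first exact: barrier_inv_next.
  have := refusal_prob p_gt0 dl0 (law_ge0 P obs c i0) good_mom badp iB.
  move=> /le_trans; apply; rewrite /phi /dl invf_div; lra.
move=> w /= /negP; rewrite -leNgt => Qw.
have a0 : {ffun 'I_p -> option 'I_m.+1} := [ffun=> None].
have [msk [sm cm gm hm]] :=
  barrier_accepted (@in_box p m) cp dl0 a0 (sample obs c w) invB0.
have nthE (i : 'I_n) : nth a0 (sample obs c w) i = c (obs i w).
  by rewrite -tnth_nth tnth_mktuple.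
rewrite size_tuple in sm.
exists [set i : 'I_n | nth false msk i]%SET; split.
  have <- : (count id msk)%:R = #|[set i : 'I_n | nth false msk i]%SET|%:R :> R.
    rewrite -sum1_card -sum1_count (big_nth false) sm big_mkord.
    by congr (_%:R); apply: eq_bigl => i; rewrite inE.
  have : (count id msk + count negb msk)%N = n by rewrite -sm -(count_predC id msk).
  by move=> /(congr1 (fun k : nat => k%:R : R)); rewrite natrD cm; lra.
move=> v; have := hm v; rewrite size_tuple big_mkord.
set D := dot v v; have D0 : 0 <= D := dotvv_ge0 v.
set s1 := \sum_(i < n | _) _ => hs1.
have B0v : dot v (B0 *m v) <= n%:R * (128 / eps) * D.
  rewrite dot_scalar -/D ler_wpM2r // /phi invf_div ler_wpM2r ?ler_nat //.
  by rewrite divr_ge0 // ltW.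
(* [B0] contributes at most 128 n / eps because p <= n, and the n shifts contribute as much. Passing
   from cell points to the x_i doubles this and adds 2 n. *)
apply: (@le_trans _ _ (2 * s1 + 2 * n%:R * D)); last by move: hs1; rewrite /dl; lra.
have -> : 2 * n%:R * D = \sum_(i < n) 2 * D.
  by rewrite sumr_const card_ord -[RHS]mulr_natl; ring.
apply: (@le_trans _ _ (\sum_(i < n | nth false msk i)
    (2 * dot (cp (c (obs i w))) v ^+ 2 + 2 * D))); last first.
  rewrite big_split /= /s1 [X in _ <= X + _]mulr_sumr; apply: lerD.
    by rewrite le_eqVlt; apply/orP; left; apply/eqP/eq_bigr => i _; rewrite nthE.
  rewrite [leRHS](bigID (fun i : 'I_n => nth false msk i)) /= lerDl.
  by apply: sumr_ge0 => i _; rewrite mulr_ge0.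
rewrite (eq_bigl (fun i : 'I_n => nth false msk i)) => [|i]; last by rewrite inE.
apply: ler_sum => i mi; have := gm i mi; rewrite nthE => box.
set e := x i w - cp (c (obs i w)).
have ee : dot e e <= 1.
  apply: (@le_trans _ _ (\sum_(k < p) p%:R^-1)); last first.
    by rewrite sumr_const card_ord -[leLHS]mulr_natr mulVf ?gt_eqF.
  apply: ler_sum => k _; rewrite -expr2.
  have := cell_point_close eta0 radm k box; rewrite tnth_mktuple => h.
  have {}h : `|e k 0| <= p%:R^-1 by rewrite /e !mxE distrC; rewrite mxE in h.
  rewrite -[e k 0 ^+ 2]real_normK ?num_real //.
  have p1 : p%:R^-1 <= 1 :> R by rewrite invf_le1 // ler1n.
  apply: le_trans (_ : `|e k 0| <= _); last by [].
  by rewrite expr2 ler_piMl //; apply: le_trans p1.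
have ev : dot e v ^+ 2 <= D.
  by apply: le_trans (dot_cauchy_schwarz _ _) _; rewrite ler_piMl.
have -> : x i w = cp (c (obs i w)) + e by rewrite /e addrC subrK.
rewrite dotDl; have := sqr_ge0 (dot (cp (c (obs i w))) v - dot e v).
by rewrite sqrrB sqrrD; lra.
Qed.

End CovariateBound.

(** * High-probability events for the noise and for the margins *)

Section GoodEvent.
Context {R : realType} {d : measure_display} {Omega : measurableType d}.
Variables (P : probability Omega R) (p n : nat).
Variables (x : 'I_n -> Omega -> 'cV[R]_p) (z : 'I_n -> Omega -> R).
Hypothesis iid : iid_pairs P x z.
Variable i0 : 'I_n.

Let obs i := pair_obs (x i) (z i).

Lemma noise_bounded_whp (kappa gamma : R) : 0 < gamma ->
  ('E_P[fun w => (`|z i0 w|)%R] = kappa%:E)%E ->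
  exists Ev : set Omega,
    [/\ measurable Ev, (P (~` Ev) <= (expR (- (gamma / 4 * n%:R)))%:E)%E &
     forall w, Ev w ->
       \sum_j (4 / gamma * kappa < `|z j w|)%R%:R <= gamma * n%:R].
Proof.
move=> g0; rewrite unlock => zk; have [mobs obs_id obs_indep] := iid.
pose D (e : p.-tuple R * R) := 4 / gamma * kappa < `|e.2|.
have mD : measurable [set e | D e].
  rewrite -[X in measurable X]setTI.
  have -> : [set e | D e] =
      (fun e : p.-tuple R * R => `|e.2|) @^-1` `]4 / gamma * kappa, +oo[.
    by apply/seteqP; split=> e; rewrite /D /= in_itv /= andbT.
  have m2 : measurable_fun setT (fun e : p.-tuple R * R => e.2) by exact: measurable_snd.
  by apply: (measurable_abs m2) => //; exact: measurable_itv.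
pose Bad := [set w | gamma * n%:R <= \sum_j (D (obs j w))%:R].
have mBad : measurable Bad.
  exact: (measurable_count mobs (fun r : R => gamma * n%:R <= r) mD).
exists (~` Bad); split; first exact: measurableC.
  rewrite setCK; have := @count_upper_tail _ _ _ _ _ P n obs mobs obs_id obs_indep D i0 gamma mD; apply.
  have -> : gamma / 4 = (4 / gamma)^-1 by rewrite invf_div.
  by apply: prob_gt_scaled_mean => //; [exact: (measurable_noise iid)|exact: divr_gt0].
by move=> w /negP; rewrite -ltNge => /ltW.
Qed.

Hypothesis p_gt0 : (0 < p)%N.
Hypothesis x_iso : second_moment_id P (x i0).

(** The small-ball bound is applied to v / |v|; a margin 1/2 there is a margin at least 1/4 for v,
    as |v| >= 1/2. *)
Lemma margin_count_whp (s C : R) (v : 'cV[R]_p) :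
  hypercontractive42 P (x i0) s -> s <= C -> 0 < C -> 2^-1 <= norm2 v ->
  exists Bad : set Omega,
    [/\ measurable Bad,
       (P Bad <= (expR (- ((2 * C ^+ 4)^-1 / 4 * n%:R)))%:E)%E &
     forall w, ~ Bad w ->
       (2 * C ^+ 4)^-1 / 4 * n%:R
         <= \sum_j (4^-1 <= `|dot (x j w) v|)%R%:R].
Proof.
move=> hyp sC C0 v2; have [mobs obs_id obs_indep] := iid.
have v0 : 0 < norm2 v by apply: lt_le_trans v2; rewrite invr_gt0.
pose D (e : p.-tuple R * R) := 4^-1 <= `|\sum_k tnth e.1 k * v k 0|.
have DE j w : D (obs j w) = (4^-1 <= `|dot (x j w) v|).
  rewrite /D /dot; congr (_ <= `|_|).
  by apply: eq_bigr => k _; rewrite tnth_mktuple.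
have mD : measurable [set e | D e].
  apply: measurable_le_fun; apply: measurable_abs; apply: measurable_sum => k.
  apply: measurable_funM => //.
  apply: (@measurableT_comp _ _ _ _ _ _ (fun t : p.-tuple R => tnth t k)) => //=.
  exact: measurable_tnth.
pose Bad := [set w | \sum_j (D (obs j w))%:R <= (2 * C ^+ 4)^-1 / 4 * n%:R].
exists Bad; split.
- exact: (measurable_count mobs (fun r : R => r <= (2 * C ^+ 4)^-1 / 4 * n%:R) mD).
- have := @count_lower_tail _ _ _ _ _ P n obs mobs obs_id obs_indep D i0
    (2 * C ^+ 4)^-1 mD; apply.
  have u1 : norm2 ((norm2 v)^-1 *: v) = 1.
    by rewrite norm2Z ger0_norm ?invr_ge0 ?ltW // mulVf // gt_eqF.
  have mx := measurable_coord iid i0.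
  apply: le_trans (small_ball mx x_iso hyp sC C0 u1) _.
  have mpre : measurable (obs i0 @^-1` [set e | D e]).
    by rewrite -[X in measurable X]setTI; apply: mobs.
  apply: le_measure; rewrite ?inE //.
    by apply: measurable_le_fun; apply: measurable_abs; exact: measurable_dot.
  have vi : 0 <= (norm2 v)^-1 by rewrite invr_ge0 norm2_ge0.
  move=> w /=; rewrite DE dotZl normrM (ger0_norm vi) dotC.
  rewrite ler_pdivlMl // => h; apply: le_trans h.
  have -> : 4^-1 = 2^-1 * 2^-1 :> R by field.
  by rewrite ler_wpM2r // invr_ge0.
- move=> w /negP; rewrite -ltNge => /ltW h; apply: le_trans h _.
  by rewrite le_eqVlt; apply/orP; left; apply/eqP/eq_bigr => j _; rewrite DE.
Qed.

Lemma margin_net_whp (s C : R) (m0 : nat) :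
  hypercontractive42 P (x i0) s -> s <= C -> 0 < C -> (1 < m0)%N ->
  exists Ev : set Omega,
    [/\ measurable Ev,
       (P (~` Ev) <= ((2 * (p * m0)).+1%:R ^+ p *
          expR (- ((2 * C ^+ 4)^-1 / 4 * n%:R)))%:E)%E &
     forall w, Ev w -> forall u, norm2 u = 1 ->
       exists v, norm2 (u - v) <= m0%:R^-1 /\
         (2 * C ^+ 4)^-1 / 4 * n%:R
           <= \sum_j (4^-1 <= `|dot (x j w) v|)%R%:R].
Proof.
move=> hyp sC C0 m01; set b := expR _.
have m00 : (0 < m0)%N by apply: leq_trans m01.
have badP (k : {ffun 'I_p -> 'I_(2 * (p * m0)).+1}) : exists Bad : set Omega,
    [/\ measurable Bad, (P Bad <= b%:E)%E &
     2^-1 <= norm2 (grid_point R k) -> forall w, ~ Bad w ->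
       (2 * C ^+ 4)^-1 / 4 * n%:R
         <= \sum_j (4^-1 <= `|dot (x j w) (grid_point R k)|)%R%:R].
  have [k2|k2] := leP 2^-1 (norm2 (grid_point R k)).
    have [Bad [h1 h2 h3]] := margin_count_whp hyp sC C0 k2.
    by exists Bad; split.
  (* A grid point of norm below 1/2 gets an empty bad event: it is never the one chosen for a unit
     vector, whose neighbour has norm at least 1 - 1/m0 >= 1/2. *)
  exists set0; split; rewrite ?measure0 ?lee_fin ?expR_ge0 //.
have [Bad hBad] := choice badP.
exists (~` \big[setU/set0]_k Bad k); split.
- by apply: measurableC; apply: bigsetU_measurable => k _; have [] := hBad k.
- rewrite setCK; apply: le_trans (measure_bigsetU_le _ _ _ _) _.
    by move=> k; have [] := hBad k.
  apply: (@le_trans _ _ (\sum_(k : {ffun 'I_p -> 'I_(2 * (p * m0)).+1}) b%:E)%E).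
    by apply: lee_sum => k _; have [] := hBad k.
  rewrite sumEFin lee_fin sumr_const card_ffun !card_ord.
  by rewrite -[leLHS]mulr_natl natrX.
- move=> w nBad u u1; have [k uk] := grid_net p_gt0 m00 u1.
  exists (grid_point R k); split=> //.
  have [_ _ h] := hBad k; apply: h.
    have := norm2_triangle (u - grid_point R k) (grid_point R k).
    rewrite subrK u1 => h; have : m0%:R^-1 <= 2^-1 :> R.
      by rewrite lef_pV2 ?posrE ?ltr0n // ler_nat.
    by lra.
  by move=> bw; apply: nBad; rewrite (bigD1 k) //=; left.
Qed.

End GoodEvent.

(** * Success probability *)

Lemma fprob_mono (R : realType) (A : finType) (mu : fdist R A) (E1 E2 : set A) :
  E1 `<=` E2 -> fprob mu E1 <= fprob mu E2.
Proof.
move=> E12; rewrite /fprob [leRHS](bigID (fun a => `[< E1 a >])) /=.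
rewrite [X in _ <= X + _](eq_bigl (fun a => `[< E1 a >])) => [|a].
  rewrite lerDl; apply: sumr_ge0 => a _. exact: Defs.pmf_ge0.
by rewrite andb_idl // => /asboolP /E12 /asboolP.
Qed.

Lemma fprob_setT (R : realType) (A : finType) (mu : fdist R A) (E : set A) :
  (forall a, E a) -> fprob mu E = 1.
Proof.
move=> ET; rewrite -(Defs.pmf_sum1 mu); apply: eq_bigl => a.
exact/asboolP.
Qed.

Lemma fprob_ge0 (R : realType) (A : finType) (mu : fdist R A) (E : set A) :
  0 <= fprob mu E.
Proof. by apply: sumr_ge0 => a _; exact: Defs.pmf_ge0. Qed.

(** The integral of a nonnegative function is a supremum over the simple functions below it, hence
    monotone for arbitrary functions. This allows corruptions that depend on the sample in a
    nonmeasurable way. *)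
Lemma ge0_le_integral_nonmeasurable (R : realType) (d : measure_display)
    (Omega : measurableType d) (mu : {measure set Omega -> \bar R})
    (f g : Omega -> \bar R) :
  (forall w, (0 <= f w)%E) -> (forall w, (f w <= g w)%E) ->
  (\int[mu]_w f w <= \int[mu]_w g w)%E.
Proof.
move=> f0 fg; have g0 w : (0 <= g w)%E := le_trans (f0 w) (fg w).
rewrite !ge0_integralTE //; apply: le_ereal_sup => _ [h hf <-].
by exists h => //= w; apply: le_trans (hf w) _.
Qed.

(** f dominates c 1_Ev, whose integral is c - c P(~Ev) >= c - b because c <= 1. *)
Lemma integral_ge_on_event (R : realType) (d : measure_display)
    (Omega : measurableType d) (P : probability Omega R) (Ev : set Omega)
    (f : Omega -> R) (c b : R) :
  measurable Ev -> 0 <= c <= 1 -> (P (~` Ev) <= b%:E)%E ->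
  (forall w, 0 <= f w) -> (forall w, Ev w -> c <= f w) ->
  ((c - b)%:E <= \int[P]_w (f w)%:E)%E.
Proof.
move=> mE /andP[c0 c1] PE f0 cf.
apply: (@le_trans _ _ (\int[P]_w (c * \1_Ev w)%:E)%E); last first.
  apply: ge0_le_integral_nonmeasurable => w; first by rewrite lee_fin mulr_ge0.
  rewrite lee_fin indicE; case: (boolP (w \in Ev)) => [/set_mem/cf|_].
    by rewrite mulr1.
  by rewrite mulr0.
under eq_integral do rewrite EFinM.
rewrite ge0_integralZl //; last first.
  by apply/measurable_EFinP; exact: measurable_indicE.
rewrite integral_indic // setIT.
have mEc := measurableC mE.
have PEfin : P Ev \is a fin_num by exact: fin_num_measure.
have PCfin : P (~` Ev) \is a fin_num by exact: fin_num_measure.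
have r0 : 0 <= fine (P (~` Ev)) by rewrite fine_ge0.
have := probability_setC P mE.
rewrite -(fineK PCfin) lee_fin in PE.
rewrite -(fineK PCfin) -(fineK PEfin) -EFinB => -[rE].
change ((c - b)%:E <= c%:E * P Ev)%E.
rewrite -(fineK PEfin) -EFinM lee_fin.
move: rE PE r0; set r := fine _; set q := fine _ => rE rb r0.
have h : 0 <= (1 - c) * r by rewrite mulr_ge0 // subr_ge0.
by rewrite rE in h rb; lra.
Qed.

Section FilterSuccess.
Variables (R : realType) (c1 c2 c3 Cbar A a : R).
Hypotheses (c2_gt0 : 0 < c2) (c3_gt0 : 0 < c3).
Hypothesis Cbar_gt1 : 1 < Cbar.
Variables (F : filter_algorithm R).
Hypothesis F_ok : filter_guarantee F c1 c2 c3 Cbar A a.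
Variables (p n : nat) (x : 'I_n -> 'cV[R]_p) (z : 'I_n -> R).
Variables (betastar : 'cV[R]_p) (T : 'I_n -> 'cV[R]_p * R).
Variables (eps eps' gamma Lam delta cb m rho : R).

Let L := 1 + (c3 * delta) ^+ 2 / (c2 * Cbar * eps').

(** The bounded subset B is stable, so the filter returns a stable subset of the corrupted points
    with high probability. Stability of that output yields the second moment bound L on which the
    deterministic error bound relies. *)
Lemma filter_lad_success : (0 < n)%N -> 0 < cb -> 0 <= m ->
  0 < eps' -> eps' < 2^-1 -> Cbar * eps' < 2^-1 -> c2 * Cbar * eps' < 2^-1 ->
  c1 * eps' <= cb / 4 -> 0 < Lam -> 4 * Lam + 1 <= delta -> c3^-1 <= delta ->
  eps <= gamma -> gamma <= eps' -> 2 * gamma <= cb / 4 ->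
  2 * gamma * L <= (cb / 32) ^+ 2 -> rho ^+ 2 * L <= (cb / 32) ^+ 2 ->
  corrupted eps (fun i => (x i, dot (x i) betastar + z i)) T ->
  (exists B : {set 'I_n}, (1 - eps') * n%:R <= #|B|%:R /\
     forall v, \sum_(i in B) dot (x i) v ^+ 2 <= Lam * n%:R * dot v v) ->
  \sum_j (m < `|z j|)%R%:R <= gamma * n%:R ->
  (forall u, norm2 u = 1 -> exists v, norm2 (u - v) <= rho /\
     cb * n%:R <= \sum_j (4^-1 <= `|dot (x j) v|)%R%:R) ->
  1 - A * expR (- (a * (n%:R * eps'))) <=
    lad_filtering_prob F T eps'
      [set b | norm2 (b - betastar) <= 32 * m / cb].
Proof.
move=> n0 cb0 m0 e0 e2 Ce c2Ce c1e L0 Ld c3d eg ge gcb gL rL cor [B [cB BLam]] zm net.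
have nR : 0 < n%:R :> R by rewrite ltr0n.
have [s s_inj cs] := corrupted_matching cor.
have C0 : 0 < Cbar by apply: lt_trans Cbar_gt1.
have d1 : 1 <= delta by lra.
have range_in : stability_range (Cbar * eps') delta.
  by split; [rewrite mulr_gt0|lra].
have c3d1 : 1 <= c3 * delta by rewrite -ler_pdivrMl // mulr1.
have range_out : stability_range (c2 * Cbar * eps') (c3 * delta).
  by split; [rewrite !mulr_gt0|lra].
have cor' : corrupted eps' x (fun i => (T i).1).
  apply: (matching_corrupted s_inj); apply: (@le_trans _ _ ((1 - eps) * n%:R)).
    by rewrite ler_pM2r //; lra.
  apply: le_trans cs _; rewrite ler_nat; apply/subset_leq_card/fintype.subsetP => i.
  by rewrite !inE => /eqP ->.
have stB : stable x B (Cbar * eps') delta 0 1.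
  by apply: (stable_of_second_moment_le n0 L0) => //; nra.
have e01 : 0 < eps' < 2^-1 by rewrite e0.
(* The guarantee is used with C0 = Cbar, mu = 0 and sigma = 1. *)
have := F_ok (lexx Cbar) e01 ltr01 cor' cB stB range_out.
move=> /le_trans; apply; apply: fprob_mono => A1 /= [cA1 stA1] b argb.
have ALam := stable_second_moment_le n0 stA1.
have L1 : 0 < L.
  by rewrite ltr_pwDl // divr_ge0 ?sqr_ge0 // ltW // !mulr_gt0.
apply: (lad_error_le (x := x) (z := z) (T := T) (s := s) (A := A1) n0 cb0 L1 m0 c1e gcb gL rL) => //.
apply: le_trans cs; rewrite ler_pM2r //; lra.
Qed.

End FilterSuccess.

(** * Choice of constants and comparison of rates *)

Lemma dim_le_max_xlnx (R : realType) (p : nat) :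
  p%:R <= 2 * Num.max 1 (p%:R * ln p%:R) :> R.
Proof.
have [p1|p2] := leqP p 1.
  apply: (@le_trans _ _ 2); first by rewrite ler_nat; case: p p1 => [|[]].
  by rewrite ler_pMr // le_max lexx.
have pR : 0 < p%:R :> R by rewrite ltr0n (ltn_trans _ p2).
have ln2 : 2^-1 <= ln 2 :> R.
  by rewrite -[leLHS]expRK ler_ln ?posrE ?expR_gt0 // expR_half_le2.
have lnp : 2^-1 <= ln p%:R :> R.
  by apply: le_trans ln2 _; rewrite ler_ln ?posrE // ler_nat.
apply: (@le_trans _ _ (2 * (p%:R * ln p%:R))); last first.
  by rewrite ler_pM2l // le_max lexx orbT.
by have := ler_wpM2l (ltW pR) lnp; lra.
Qed.

(** The base is at most 3 m0 p, and p ln (3 m0 p) = p ln (3 m0) + p ln p, where p <= 2 X and p ln p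
    <= X for the maximum X. *)
Lemma net_card_le (R : realType) (p m0 : nat) : (0 < p)%N -> (0 < m0)%N ->
  (2 * (p * m0)).+1%:R ^+ p
    <= expR (Num.max 1 (p%:R * ln p%:R) * (2 * ln (3 * m0%:R) + 1)) :> R.
Proof.
move=> p0 m00; set X := Num.max _ _.
have pR : 0 < p%:R :> R by rewrite ltr0n.
have mR : 1 <= m0%:R :> R by rewrite ler1n.
have m3 : 0 < 3 * m0%:R :> R by lra.
have l0 : 0 <= ln (3 * m0%:R) :> R by apply: ln_ge0; lra.
apply: (@le_trans _ _ ((3 * m0%:R * p%:R) ^+ p)).
  apply: lerXn2r; rewrite ?nnegrE ?mulr_ge0 //.
  rewrite -!natrM ler_nat; have : (0 < p * m0)%N by rewrite muln_gt0 p0.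
  by move=> h; rewrite -mulnA (mulnC m0) (mulSn 2) -[leqLHS]add1n leq_add2r.
have y0 : 0 < 3 * m0%:R * p%:R :> R by rewrite mulr_gt0.
rewrite -[leLHS]lnK ?posrE ?exprn_gt0 // ler_expR lnXn //.
have lnE : ln (3 * m0%:R * p%:R) = ln (3 * m0%:R) + ln p%:R :> R.
  by rewrite lnM ?posrE.
rewrite lnE -[X in X <= _]mulr_natl mulrDr mulrDr mulr1; apply: lerD.
  by rewrite mulrA ler_wpM2r // mulrC dim_le_max_xlnx.
by rewrite /X le_max lexx orbT.
Qed.

(** Half of the exponent q0 n / 4 pays for the cardinality of the net; the other half is the
    remaining rate. *)
Lemma net_tail_le (R : realType) (p m0 n : nat) (q0 c0 : R) :
  (0 < p)%N -> (0 < m0)%N -> 0 < q0 -> c0 <= q0 / 8 ->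
  8 * (2 * ln (3 * m0%:R) + 1) / q0 * Num.max 1 (p%:R * ln p%:R) <= n%:R ->
  (2 * (p * m0)).+1%:R ^+ p * expR (- (q0 / 4 * n%:R)) <= expR (- (c0 * n%:R)).
Proof.
move=> p0 m00 q00 c0q hn.
apply: le_trans (ler_wpM2r (expR_ge0 _) (net_card_le R p0 m00)) _.
move: hn; set X := Num.max _ _; set l := 2 * ln _ + 1 => hn.
rewrite -expRD ler_expR.
have h : X * l <= q0 / 8 * n%:R.
  have -> : X * l = q0 / 8 * (8 * l / q0 * X) by field; rewrite gt_eqF.
  by rewrite ler_pM2l // divr_gt0.
by have := ler_wpM2r (ler0n R n) c0q; lra.
Qed.

(** Half of the exponent c0 n absorbs the factor 3 + A, by exp(y) >= 1 + y; the other half is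
    already below [tau] by the assumption on log (1 / tau). *)
Lemma tail_le_tau (R : realType) (n : nat) (c0 A tau : R) :
  (0 < n)%N -> 0 < c0 -> 0 < tau -> ln (1 / tau) / n%:R <= c0 / 2 ->
  2 * (3 + A) / c0 <= n%:R -> (3 + A) * expR (- (c0 * n%:R)) <= tau.
Proof.
move=> n0 c00 tau0 ltau hn; have nR : 0 < n%:R :> R by rewrite ltr0n.
have tau_rate : expR (- (c0 / 2 * n%:R)) <= tau.
  have : ln (1 / tau) <= c0 / 2 * n%:R by rewrite -ler_pdivrMr.
  rewrite div1r lnV ?posrE // => h.
  by rewrite -[leRHS]lnK ?posrE // ler_expR; lra.
apply: le_trans tau_rate.
have -> : c0 * n%:R = c0 / 2 * n%:R + c0 / 2 * n%:R by field.
rewrite opprD expRD mulrA ler_piMl ?expR_ge0 // expRN.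
rewrite ler_pdivrMr ?expR_gt0 // mul1r.
have h : 3 + A <= c0 / 2 * n%:R.
  have -> : 3 + A = c0 / 2 * (2 * (3 + A) / c0) by field; rewrite gt_eqF.
  by rewrite ler_pM2l // divr_gt0.
by have := expR_ge1Dx (c0 / 2 * n%:R); lra.
Qed.

Lemma ex_corruption_level (R : realType) (e cb L : R) :
  0 < e -> 0 < cb -> 0 < L ->
  exists g : R, [/\ 0 < g, g <= e, 2 * g <= cb / 4 & 2 * g * L <= (cb / 32) ^+ 2].
Proof.
move=> e0 cb0 L0; have cb32 : 0 < (cb / 32) ^+ 2 by rewrite exprn_gt0 // divr_gt0.
exists (Num.min e (Num.min (cb / 8) ((cb / 32) ^+ 2 / (2 * L)))); split.
- by rewrite !lt_min e0 !divr_gt0 // mulr_gt0.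
- by rewrite ge_min lexx.
- set g := Num.min _ _; have : g <= cb / 8 by rewrite !ge_min lexx orbT.
  by lra.
- set g := Num.min _ _.
  have : g <= (cb / 32) ^+ 2 / (2 * L) by rewrite !ge_min lexx !orbT.
  by rewrite ler_pdivlMr ?mulr_gt0 // mulrA (mulrC g).
Qed.

Lemma ex_net_level (R : realType) (cb L : R) : 0 < cb -> 0 < L ->
  exists2 m0 : nat, (1 < m0)%N & (m0%:R^-1) ^+ 2 * L <= (cb / 32) ^+ 2.
Proof.
move=> cb0 L0; have cb32 : 0 < (cb / 32) ^+ 2 by rewrite exprn_gt0 // divr_gt0.
exists (Num.truncn (L / (cb / 32) ^+ 2)).+2 => //; set m0 := _.+2.
have m0L : L / (cb / 32) ^+ 2 <= m0%:R.
  have /andP[_ h] := truncn_itv (ltW (divr_gt0 L0 cb32)).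
  by apply: le_trans (ltW h) _; rewrite ler_nat.
have m0R : 0 < m0%:R :> R by rewrite ltr0n.
have m1 : m0%:R^-1 <= 1 :> R by rewrite invf_le1 // ler1n.
have : m0%:R^-1 * L <= (cb / 32) ^+ 2.
  by rewrite ler_pdivrMl // -ler_pdivrMr.
apply: le_trans; rewrite ler_pM2r // expr2 ler_piMl // invr_ge0 ltW //.
Qed.

Section SuccessProbability.
Variables (R : realType) (c1 c2 c3 Cbar A a C eps' gamma delta : R) (m0 : nat).
Hypotheses (c2_gt0 : 0 < c2) (c3_gt0 : 0 < c3).
Hypotheses (Cbar_gt1 : 1 < Cbar) (A_gt0 : 0 < A) (C_gt0 : 0 < C).

Let q0 := (2 * C ^+ 4)^-1.
Let cb := q0 / 4.
Let Lam := 512 / eps' + 2.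
Let L := 1 + (c3 * delta) ^+ 2 / (c2 * Cbar * eps').

Hypotheses (eps'_gt0 : 0 < eps') (eps'_lt : eps' < 2^-1).
Hypotheses (Cbar_eps' : Cbar * eps' < 2^-1) (c2_eps' : c2 * Cbar * eps' < 2^-1).
Hypothesis c1_eps' : c1 * eps' <= cb / 4.
Hypotheses (Lam_delta : 4 * Lam + 1 <= delta) (c3_delta : c3^-1 <= delta).
Hypotheses (gamma_gt0 : 0 < gamma) (gamma_eps' : gamma <= eps').
Hypotheses (gamma_cb : 2 * gamma <= cb / 4).
Hypotheses (gamma_L : 2 * gamma * L <= (cb / 32) ^+ 2).
Hypotheses (m0_gt1 : (1 < m0)%N) (m0_L : (m0%:R^-1) ^+ 2 * L <= (cb / 32) ^+ 2).

Variable F : filter_algorithm R.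
Hypothesis F_ok : filter_guarantee F c1 c2 c3 Cbar A a.
Variables (p n : nat) (d : measure_display) (Omega : measurableType d).
Variables (P : probability Omega R).
Variables (x : 'I_n -> Omega -> 'cV[R]_p) (z : 'I_n -> Omega -> R).
Variables (betastar : 'cV[R]_p) (sigma4 kappa eps : R).
Variables (T : Omega -> 'I_n -> 'cV[R]_p * R).
Hypothesis iid : iid_pairs P x z.
Hypothesis x_iso : forall i, second_moment_id P (x i).
Hypothesis hyper : forall i, hypercontractive42 P (x i) sigma4.
Hypothesis sigma4_le : sigma4 <= C.
Hypothesis z_abs : forall i, ('E_P[fun w => (`|z i w|)%R] = kappa%:E)%E.
Hypothesis eps_gamma : eps <= gamma.
Hypothesis T_cor : forall w,
  corrupted eps (fun i => (x i w, dot (x i w) betastar + z i w)) (T w).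
Hypotheses (p_gt0 : (0 < p)%N) (p_le_n : (p <= n)%N).

(** On the intersection of the three sample events the filter succeeds with probability at least 1 -
    A exp(- a n eps'), a value in [0, 1] by hypothesis; a union bound handles the complement. *)
Lemma lad_filtering_whp : A * expR (- (a * (n%:R * eps'))) <= 1 ->
  ((1 - A * expR (- (a * (n%:R * eps'))) -
    (expR (- (eps' / 4 * n%:R)) + (expR (- (gamma / 4 * n%:R)) +
     (2 * (p * m0)).+1%:R ^+ p * expR (- (q0 / 4 * n%:R)))))%:E <=
   \int[P]_w (lad_filtering_prob F (T w) eps'
     [set b | norm2 (b - betastar) <= 32 * (4 / gamma * kappa) / cb])%:E)%E.
Proof.
move=> Aexp; have n_gt0 : (0 < n)%N := leq_trans p_gt0 p_le_n.
pose i0 : 'I_n := Ordinal n_gt0.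
have kappa0 : 0 <= kappa.
  rewrite -lee_fin -(z_abs i0) unlock; apply: integral_ge0 => w _.
  by rewrite lee_fin.
have Lam0 : 0 < Lam.
  by apply: addr_gt0; [apply: divr_gt0|]; rewrite ?ltr0n.
have cb0 : 0 < cb by rewrite divr_gt0 // invr_gt0 mulr_gt0 // exprn_gt0.
have e01 : 0 < eps' < 1.
  by rewrite eps'_gt0 (lt_trans eps'_lt) // invf_lt1 ?ltr1n.
have [E1 [mE1 PE1 hE1]] := covariates_bounded_whp iid p_gt0 p_le_n (x_iso i0) e01.
have [E2 [mE2 PE2 hE2]] := noise_bounded_whp iid gamma_gt0 (z_abs i0).
have [E3 [mE3 PE3 hE3]] :=
  margin_net_whp iid p_gt0 (x_iso i0) (hyper i0) sigma4_le C_gt0 m0_gt1.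
have mEv : measurable (E1 `&` (E2 `&` E3)).
  by apply: measurableI => //; exact: measurableI.
apply: (integral_ge_on_event mEv).
- by rewrite subr_ge0 Aexp gerBl mulr_ge0 ?expR_ge0 // ltW.
- rewrite !setCI; apply: le_trans (measureU2 _ _ _) _.
  + exact: measurableC.
  + by apply: measurableU; exact: measurableC.
  rewrite EFinD; apply: leeD => //.
  apply: le_trans (measureU2 _ _ _) _; [exact: measurableC|exact: measurableC|].
  by rewrite EFinD; apply: leeD.
- by move=> w; exact: fprob_ge0.
move=> w [w1 [w2 w3]].
have mk : 0 <= 4 / gamma * kappa by rewrite mulr_ge0 // ltW // divr_gt0.
apply: (filter_lad_success (Lam := Lam) (delta := delta) (eps := eps)
  (gamma := gamma) (rho := m0%:R^-1) c2_gt0 c3_gt0 Cbar_gt1 F_ok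
  (x := fun i => x i w) (z := fun i => z i w)) => //.
- exact: hE1.
- exact: hE2.
- exact: hE3.
Qed.

End SuccessProbability.

Theorem theorem5p2 (R : realType) (c1 c2 c3 Cbar A a : R) :
  0 < c1 -> 0 < c2 -> 0 < c3 -> 1 < Cbar -> 0 < A -> 0 < a ->
  forall C : R,
  exists eps0 : R, 0 < eps0 /\
  forall eps' : R, 0 < eps' < eps0 ->
  exists cstar ctau Cn K : R,
    [/\ 0 < cstar, 0 < ctau, 0 < Cn & 0 < K] /\
  forall (F : filter_algorithm R), filter_guarantee F c1 c2 c3 Cbar A a ->
  forall (p n : nat) (d : measure_display) (Omega : measurableType d)
         (P : probability Omega R)
         (x : 'I_n -> Omega -> 'cV[R]_p) (z y : 'I_n -> Omega -> R)
         (betastar : 'cV[R]_p) (sigma4 kappa eps tau : R)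
         (T : Omega -> 'I_n -> 'cV[R]_p * R),
    iid_pairs P x z ->
    (forall i w, y i w = dot (x i w) betastar + z i w) ->
    (forall i, mean_zero P (x i)) ->
    (forall i, second_moment_id P (x i)) ->
    (forall i, hypercontractive42 P (x i) sigma4) -> sigma4 <= C ->
    (forall i, 'E_P[fun w => (`|z i w|)%R] = kappa%:E)%E ->
    0 <= eps < cstar ->
    (forall w, corrupted eps (fun i => (x i w, y i w)) (T w)) ->
    0 < tau < 1 -> ln (1 / tau) / n%:R <= ctau ->
    (* for p >= 2 the maximum is p log p *)
    Cn * Num.max 1 (p%:R * ln p%:R) <= n%:R ->
    (* T is an arbitrary map, so the integrand need not be measurable: the
       integral of a nonnegative function is then its lower integral *)
    ((1 - tau)%:E <=
       \int[P]_w (lad_filtering_prob F (T w) eps'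
                    [set b | norm2 (b - betastar) <= K * kappa])%:E)%E.
Proof.
move=> c1_gt0 c2_gt0 c3_gt0 Cbar_gt1 A_gt0 a_gt0 C.
(* A positive upper bound for C, which may be of any sign. *)
pose C' : R := 1 + `|C|.
have C'_gt0 : 0 < C' by rewrite ltr_pwDl.
have CC' : C <= C' by apply: le_trans (ler_norm C) _; rewrite lerDr.
pose q0 : R := (2 * C' ^+ 4)^-1; pose cb := q0 / 4.
have q0_gt0 : 0 < q0 by rewrite invr_gt0 mulr_gt0 // exprn_gt0.
have cb_gt0 : 0 < cb by rewrite divr_gt0.
have Cbar_gt0 : 0 < Cbar by apply: lt_trans Cbar_gt1.
have cC_gt0 : 0 < c2 * Cbar by rewrite mulr_gt0.
(* The four bounds give, in order, eps' < 1/2, the stability ranges of the input and of the output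
   of the filter, and c1 eps' <= cb / 4. *)
exists (Num.min 2^-1 (Num.min (2^-1 / Cbar)
  (Num.min (2^-1 / (c2 * Cbar)) (cb / 4 / c1)))); split.
  have h2 : 0 < 2^-1 :> R by rewrite invr_gt0 ltr0n.
  by rewrite !lt_min h2 !divr_gt0.
move=> eps' /andP[e_gt0]; rewrite !lt_min => /and4P[e2].
rewrite (ltr_pdivlMr _ _ Cbar_gt0) (ltr_pdivlMr _ _ cC_gt0).
rewrite (ltr_pdivlMr _ _ c1_gt0) !(mulrC eps').
move=> Ce c2Ce /ltW c1e.
(* The order of the choices matters: [Lam] depends on eps', [delta] on [Lam], and [L] on [delta];
   the corruption level [gamma] and the net level [m0] are then adapted to [L]. *)
pose Lam := 512 / eps' + 2; pose delta := 4 * Lam + 1 + c3^-1.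
pose L := 1 + (c3 * delta) ^+ 2 / (c2 * Cbar * eps').
have c3i : 0 <= c3^-1 by rewrite invr_ge0 ltW.
have Lam_ge0 : 0 <= 4 * Lam + 1.
  apply: addr_ge0 => //; apply: mulr_ge0; first by rewrite ler0n.
  by apply: addr_ge0; [apply: divr_ge0; [rewrite ler0n|exact: ltW]|rewrite ler0n].
have L_gt0 : 0 < L.
  by rewrite ltr_pwDl // divr_ge0 ?sqr_ge0 // ltW // mulr_gt0.
have [gamma [g_gt0 ge gcb gL]] := ex_corruption_level e_gt0 cb_gt0 L_gt0.
have [m0 m0_gt1 rL] := ex_net_level cb_gt0 L_gt0.
(* The slowest of the four failure rates: deletions, noise, net and filter. *)
pose c0 := Num.min (eps' / 4) (Num.min (gamma / 4)
  (Num.min (q0 / 8) (a * eps'))).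
have c0_gt0 : 0 < c0 by rewrite !lt_min !divr_gt0 // mulr_gt0.
have c0e : c0 <= eps' / 4 by rewrite !ge_min lexx.
have c0g : c0 <= gamma / 4 by rewrite !ge_min lexx !orbT.
have c0q : c0 <= q0 / 8 by rewrite !ge_min lexx !orbT.
have c0a : c0 <= a * eps' by rewrite !ge_min lexx !orbT.
pose l3 : R := 2 * ln (3 * m0%:R) + 1.
(* The entries ensure, in order, p <= n, the absorption of the factor 3 + A, and the union bound
   over the net. *)
pose Cn := Num.max 2 (Num.max (2 * (3 + A) / c0) (8 * l3 / q0)).
have Cn2 : 2 <= Cn by rewrite le_max lexx.
have CnA : 2 * (3 + A) / c0 <= Cn by rewrite !le_max lexx orbT.
have Cnl : 8 * l3 / q0 <= Cn by rewrite !le_max lexx !orbT.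
have Cn0 : 0 < Cn by apply: lt_le_trans Cn2.
have K_gt0 : 0 < 32 * (4 / gamma) / cb by rewrite !(divr_gt0, mulr_gt0) // ltr0n.
exists gamma, (c0 / 2), Cn, (32 * (4 / gamma) / cb); split.
  by split=> //; exact: divr_gt0.
move=> F F_ok p n d Omega P x z y betastar sigma4 kappa eps tau T iid yE _ x_iso
  hyp sC zk /andP[eps0 eps_lt] cor /andP[tau0 tau1] ltau hn.
have pX := dim_le_max_xlnx R p; set X := Num.max _ _ in hn pX.
have X1 : 1 <= X by rewrite le_max lexx.
have X0 : 0 < X by apply: lt_le_trans X1.
have nCn : Cn <= n%:R by apply: le_trans hn; rewrite ler_peMr // ltW.
have nR : 0 < n%:R :> R by apply: lt_le_trans nCn.
have n_gt0 : (0 < n)%N by rewrite -(ltr0n R).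
pose i0 : 'I_n := Ordinal n_gt0.
have kappa0 : 0 <= kappa.
  rewrite -lee_fin -(zk i0) unlock; apply: integral_ge0 => w _.
  by rewrite lee_fin.
(* In dimension 0 the error is always 0. *)
have [p0|p_gt0] := posnP p.
  apply: (@le_trans _ _ (\int[P]_w 1%:E)%E).
    rewrite integral_cst // mul1e [X in (_ <= X)%E](probability_setT P).
    by rewrite lee_fin gerBl ltW.
  apply: ge0_le_integral_nonmeasurable => w; first by rewrite lee_fin.
  rewrite lee_fin /lad_filtering_prob fprob_setT // => A1 b _ /=.
  have -> : norm2 (b - betastar) = 0.
    by rewrite /norm2 big1 ?sqrtr0 // => k; case: k => k kp; exfalso; rewrite p0 in kp.
  by rewrite mulr_ge0 // ltW.
have pn : (p <= n)%N.
  by rewrite -(ler_nat R); apply: le_trans pX (le_trans _ hn); rewrite ler_pM2r.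
pose r := expR (- (c0 * n%:R)).
have rate c : c0 <= c -> expR (- (c * n%:R)) <= r.
  by move=> h; rewrite ler_expR lerN2 ler_pM2r.
have net_rate : (2 * (p * m0)).+1%:R ^+ p * expR (- (q0 / 4 * n%:R)) <= r.
  apply: net_tail_le (ltnW m0_gt1) q0_gt0 c0q _ => //.
  by apply: le_trans hn; rewrite ler_pM2r.
have tau_ge : (3 + A) * r <= tau.
  by apply: tail_le_tau => //; apply: le_trans nCn.
have filt : A * expR (- (a * (n%:R * eps'))) <= A * r.
  by rewrite ler_pM2l // (mulrC n%:R) mulrA; exact: rate.
have r0 : 0 <= r := expR_ge0 _.
have Ar1 : A * r <= 1.
  apply: le_trans (ltW tau1); apply: le_trans tau_ge.
  by rewrite ler_wpM2r // lerDr ler0n.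
have corxz w : corrupted eps (fun i => (x i w, dot (x i w) betastar + z i w)) (T w).
  have -> : (fun i => (x i w, dot (x i w) betastar + z i w)) = (fun i => (x i w, y i w)).
    by apply/funext => i; rewrite yE.
  exact: cor.
have main := lad_filtering_whp (C := C') (delta := delta) c2_gt0 c3_gt0 Cbar_gt1 A_gt0 C'_gt0
  e_gt0 e2 Ce c2Ce c1e _ _ g_gt0 ge gcb gL m0_gt1 rL F_ok iid x_iso hyp
  (le_trans sC CC') zk (ltW eps_lt) corxz p_gt0 pn (le_trans filt Ar1).
have -> : 32 * (4 / gamma) / cb * kappa = 32 * (4 / gamma * kappa) / cb by ring.
(* The three sample failures cost at most r each and the filter at most A r; together (3 + A) r <=
   tau. *)
apply: le_trans (main _ _); rewrite ?lee_fin.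
- have h1 := rate _ c0e; have h2 := rate _ c0g.
  move: tau_ge filt h1 h2 net_rate; clear; lra.
- by rewrite /delta lerDl.
- by rewrite /delta lerDr.
Qed.
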